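(* Let $n\ge1$. In $\mathcal{BK}_{2n}$ one has $t_i^{A_{2n-1}}\tilde t^{A_{2n-1}}_{2n-i}=\tilde t^{A_{2n-1}}_{2n-i}t_i^{A_{2n-1}}$ for $1\le i<n$, and $q^{A_{2n-1}}_{[n-i+1,n+i-1]}q^{A_{2n-1}}_{[n-i+2,n+i-2]}=q^{A_{2n-1}}_{[n-i+2,n+i-2]}q^{A_{2n-1}}_{[n-i+1,n+i-1]}$ for $1\le i\le n$ (with $q^{A_{2n-1}}_{[n+1,n-1]}:=1$), and the $2n-1$ involutions $$t^{A_{2n-1}}_{\{i\}\sqcup\{2n-i\}}:=t_i^{A_{2n-1}}\tilde t^{A_{2n-1}}_{2n-i}\ (1\le i<n),\qquad t^{A_{2n-1}}_{[n-i+1,n+i]}:=q^{A_{2n-1}}_{[n-i+1,n+i-1]}q^{A_{2n-1}}_{[n-i+2,n+i-2]}\ (1\le i\le n)$$ (the virtual symplectic Bender–Knuth involutions) generate the virtual symplectic Berenstein–Kirillov group $\widetilde{\mathcal{BK}}_{2n}$.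
   Context: **Bender–Knuth involutions.** For $i\ge1$, $t_i$ acts on a semistandard tableau $T$ as follows: within each column containing both $i$ and $i+1$ these two entries are fixed; the other occurrences of $i$ and $i+1$ are free; in each row with $k$ free $i$'s followed by $l$ free $(i+1)$'s, replace them by $l$ free $i$'s followed by $k$ free $(i+1)$'s. **Berenstein–Kirillov group.** $\mathcal{BK}_{2n}$ is the group generated by $t_1,\dots,t_{2n-1}$ modulo the relations they satisfy on semistandard tableaux of any straight shape; equivalently the subgroup they generate in the group of permutations of $\bigsqcup_\mu\mathsf{SSYT}(\mu,2n)$, with $\mathsf{SSYT}(\mu,2n)$ the semistandard tableaux of shape $\mu$ with entries in $[2n]$. The superscript $A_{2n-1}$ marks elements of this group: $t_i^{A_{2n-1}}=t_i$; $q^{A_{2n-1}}_{[1,i]}:=t_1(t_2t_1)\cdots(t_it_{i-1}\cdots t_1)$; $q^{A_{2n-1}}_{[j,k-1]}:=q_{[1,k-1]}q_{[1,k-j]}q_{[1,k-1]}$ for $j<k$ (all of these are involutions; on straight shapes $q_{[i,j]}$ is the partial Schützenberger involution for the letters $i,\dots,j+1$). Dual elements: $\tilde t^{A_{2n-1}}_{2n-i}:=q_{[1,2n-1]}t_iq_{[1,2n-1]}$ for $1\le i<2n$, and $\tilde q^{A_{2n-1}}_{[1,i]}:=q_{[1,2n-1]}q_{[1,i]}q_{[1,2n-1]}=q^{A_{2n-1}}_{[2n-i,2n-1]}$. **Virtual symplectic Berenstein–Kirillov group.** $\widetilde{\mathcal{BK}}_{2n}$ is the subgroup of $\mathcal{BK}_{2n}$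 generated by the $2n-1$ involutions $q^{A_{2n-1}}_{[1,i]\sqcup[2n-i,2n-1]}:=q^{A_{2n-1}}_{[1,i]}q^{A_{2n-1}}_{[2n-i,2n-1]}$ ($1\le i<n$) and $q^{A_{2n-1}}_{[i,2n-i]}$ ($1\le i\le n$). *)

(* Defs.v *)
From HB Require Import structures.
From mathcomp Require Import all_boot.
From mathcomp Require Import boolp classical_sets.

Set Implicit Arguments.
Unset Strict Implicit.
Unset Printing Implicit Defensive.

Section Generated.
Local Open Scope group_scope.
Local Open Scope classical_set_scope.
Variable G : groupType.

Definition is_subgroup (H : set G) : Prop :=
  [/\ H 1, forall x y, H x -> H y -> H (x * y) & forall x, H x -> H x^-1].

Definition generated (S : set G) : set G := smallest is_subgroup S.

Lemma generatedP (S : set G) : is_subgroup (generated S).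
Proof.
split=> [H [[]]//|x y Sx Sy H HS|x Sx H HS].
- by case: (HS) => [[_ HM _] _]; apply: HM; [apply: Sx|apply: Sy].
- by case: (HS) => [[_ _ HV] _]; apply: HV; apply: Sx.
Qed.

End Generated.

Section Permutations.
Variable T : choiceType.

(** A permutation of a possibly infinite type is stored together with its
    two-sided inverse. *)
Definition is_permutation (p : (T -> T) * (T -> T)) : bool :=
  `[< cancel p.1 p.2 /\ cancel p.2 p.1 >].

Record permutation :=
  Permutation { perm_pair : (T -> T) * (T -> T); _ : is_permutation perm_pair }.

HB.instance Definition _ := [isSub for perm_pair].
HB.instance Definition _ := [Choice of permutation by <:].

Definition perm_fun (p : permutation) : T -> T := (perm_pair p).1.
Coercion perm_fun : permutation >-> Funclass.

Lemma permutation_cancel (p : permutation) :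
  cancel (perm_pair p).1 (perm_pair p).2 /\
  cancel (perm_pair p).2 (perm_pair p).1.
Proof. by case: p => p /= /asboolP. Qed.

Lemma permutation_ext (p q : permutation) : p =1 q -> p = q.
Proof.
move=> pq; apply: val_inj; rewrite /= (surjective_pairing (perm_pair p)).
rewrite (surjective_pairing (perm_pair q)); congr (_, _).
  by apply/funext => x; exact: pq.
have [_ pK] := permutation_cancel p; have [qK _] := permutation_cancel q.
apply/funext => x; rewrite -[LHS]qK.
by have := pq ((perm_pair p).2 x); rewrite /perm_fun => <-; rewrite pK.
Qed.

Lemma permutation_one_subproof : is_permutation (id, id).
Proof. by apply/asboolP; split. Qed.

Lemma permutation_mul_subproof (p q : permutation) :
  is_permutation ((perm_pair p).1 \o (perm_pair q).1,
                  (perm_pair q).2 \o (perm_pair p).2).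
Proof.
have [pK pV] := permutation_cancel p; have [qK qV] := permutation_cancel q.
by apply/asboolP; split; exact: can_comp.
Qed.

Lemma permutation_inv_subproof (p : permutation) :
  is_permutation ((perm_pair p).2, (perm_pair p).1).
Proof. by apply/asboolP; have [] := permutation_cancel p. Qed.

(** Products act on the left: [(p * q) x = p (q x)]. *)
Definition permutation_one := Permutation permutation_one_subproof.
Definition permutation_mul p q := Permutation (permutation_mul_subproof p q).
Definition permutation_inv p := Permutation (permutation_inv_subproof p).

Lemma permutation_mulA : associative permutation_mul.
Proof. by move=> p q r; exact: permutation_ext. Qed.
Lemma permutation_mul1 : left_id permutation_one permutation_mul.
Proof. by move=> p; exact: permutation_ext. Qed.
Lemma permutation_mulr1 : right_id permutation_one permutation_mul.
Proof. by move=> p; exact: permutation_ext. Qed.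
Lemma permutation_mulV :
  left_inverse permutation_one permutation_inv permutation_mul.
Proof.
by move=> p; apply: permutation_ext => x; have [pK _] := permutation_cancel p;
   exact: pK.
Qed.
Lemma permutation_mulrV :
  right_inverse permutation_one permutation_inv permutation_mul.
Proof.
by move=> p; apply: permutation_ext => x; have [_ pK] := permutation_cancel p;
   exact: pK.
Qed.

HB.instance Definition _ := isGroup.Build permutation
  permutation_mulA permutation_mul1 permutation_mulr1
  permutation_mulV permutation_mulrV.

Lemma involution_subproof (f : T -> T) (fK : involutive f) :
  is_permutation (f, f).
Proof. by apply/asboolP; split. Qed.

Definition involution_perm (f : T -> T) (fK : involutive f) : permutation :=
  Permutation (involution_subproof fK).

End Permutations.

(** A tableau is the sequence of its rows (English notation); its shape is the
    sequence of the row lengths, [shape] of the library.  Hence the type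
    [ssyt m] of all semistandard tableaux with entries in [1, m] is the
    disjoint union of the sets SSYT(mu, m) over all partitions mu. *)

Definition is_partition (mu : seq nat) : bool :=
  sorted geq mu && (0 \notin mu).

(** [zip] drops the cells of the upper row that have nothing below them. *)
Definition column_strict (row row' : seq nat) : bool :=
  all (fun p => p.1 < p.2) (zip row row').

Definition is_ssyt (m : nat) (T : seq (seq nat)) : bool :=
  [&& is_partition (shape T),
      all (all (fun x => 0 < x <= m)) T,
      all (sorted leq) T
    & sorted column_strict T].

Record ssyt (m : nat) := SSYT { rows :> seq (seq nat); _ : is_ssyt m rows }.

HB.instance Definition _ m := [isSub for @rows m].
HB.instance Definition _ m := [Choice of ssyt m by <:].

(** Rows and columns are numbered from 0; [entry T r c] is 0, which is never an
    entry of a semistandard tableau, when (r, c) is not a cell of [T]. *)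
Definition row (T : seq (seq nat)) (r : nat) : seq nat := nth [::] T r.
Definition entry (T : seq (seq nat)) (r c : nat) : nat := nth 0 (row T r) c.
Definition column (T : seq (seq nat)) (c : nat) : seq nat :=
  [seq nth 0 s c | s <- T].

Definition is_free (i : nat) (T : seq (seq nat)) (r c : nat) : bool :=
  (entry T r c \in [:: i; i.+1])
  && ~~ ((i \in column T c) && (i.+1 \in column T c)).

Definition free_columns (i : nat) (T : seq (seq nat)) (r : nat) : seq nat :=
  [seq c <- iota 0 (size (row T r)) | is_free i T r c].

Definition free_succs (i : nat) (T : seq (seq nat)) (r : nat) : nat :=
  count (fun c => entry T r c == i.+1) (free_columns i T r).

(** If row r has l free (i+1)'s, its l leftmost free cells receive i and its
    other free cells receive i+1. *)
Definition bk_entry (i : nat) (T : seq (seq nat)) (r c : nat) : nat :=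
  if is_free i T r c then
    if index c (free_columns i T r) < free_succs i T r then i else i.+1
  else entry T r c.

Definition bk_rows (i : nat) (T : seq (seq nat)) : seq (seq nat) :=
  mkseq (fun r => mkseq (bk_entry i T r) (size (row T r))) (size T).

Section BenderKnuthFacts.

Lemma size_row_bk i T r : size (row (bk_rows i T) r) = size (row T r).
Proof.
rewrite /row /bk_rows; have [rT|rT] := ltnP r (size T).
  by rewrite nth_mkseq // size_mkseq.
by rewrite !nth_default // size_mkseq.
Qed.

Lemma shape_bk i T : shape (bk_rows i T) = shape T.
Proof.
apply: (@eq_from_nth _ 0); rewrite /shape !size_map ?size_iota // => r rT.
rewrite !(nth_map [::]) ?size_mkseq ?size_iota //; exact: size_row_bk.
Qed.

Lemma entry_out T r c : size (row T r) <= c -> entry T r c = 0.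
Proof. exact: nth_default. Qed.

Lemma is_free_in i T r c : 0 < i -> is_free i T r c -> c < size (row T r).
Proof.
move=> i0 /andP[+ _]; rewrite ltnNge; apply: contraL => /entry_out ->.
by rewrite !inE; case: i i0.
Qed.

Lemma entry_bk i T r c : 0 < i -> entry (bk_rows i T) r c = bk_entry i T r c.
Proof.
move=> i0; have [cT|cT] := ltnP c (size (row T r)); last first.
  rewrite entry_out ?size_row_bk // /bk_entry.
  by case: ifP => [/(is_free_in i0)|_]; [rewrite ltnNge cT|rewrite entry_out].
have rT : r < size T.
  by rewrite ltnNge; apply/negP => rT; move: cT; rewrite /row nth_default.
by rewrite {1}/entry {1}/row /bk_rows nth_mkseq // nth_mkseq.
Qed.

Lemma mem_column i T c : 0 < i ->
  reflect (exists r, entry T r c = i) (i \in column T c).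
Proof.
move=> i0; apply: (iffP mapP) => [[s sT ->]|[r e]].
  by exists (index s T); rewrite /entry /row nth_index.
exists (row T r); last by rewrite -e.
rewrite mem_nth // ltnNge; apply/negP => rT.
by move: e i0; rewrite /entry /row [nth _ T r]nth_default // nth_nil => <-.
Qed.

Lemma is_ssytP m T : reflect
  [/\ is_partition (shape T),
      forall r c, c < size (row T r) -> 0 < entry T r c <= m,
      forall r c, c.+1 < size (row T r) -> entry T r c <= entry T r c.+1
    & forall r c, c < size (row T r) -> c < size (row T r.+1) ->
        entry T r c < entry T r.+1 c]
  (is_ssyt m T).
Proof.
have inT r c : c < size (row T r) -> r < size T.
  by rewrite ltnNge; case: leqP => // rT; rewrite /row nth_default.
apply: (iffP and4P) => -[pT].
  move=> /(all_nthP [::]) bT /(all_nthP [::]) rT /(sortedP [::]) cT.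
  split=> // r c rc.
  - by have /(all_nthP 0) := bT r (inT _ _ rc); apply.
  - by have /(sortedP 0) := rT r (inT _ _ (ltnW rc)); apply.
  - move=> rc'; have /(all_nthP (0, 0)) := cT r (inT _ _ rc').
    move=> /(_ c); rewrite size_zip leq_min rc rc' => /(_ isT).
    by rewrite nth_zip_cond size_zip leq_min rc rc'.
move=> bT rT cT; split=> //.
- by apply/(all_nthP [::]) => r _; apply/(all_nthP 0) => c; exact: bT.
- by apply/(all_nthP [::]) => r _; apply/(sortedP 0) => c; exact: rT.
- apply/(sortedP [::]) => r _; apply/(all_nthP (0, 0)) => c cs.
  rewrite nth_zip_cond cs /=; move: cs; rewrite size_zip leq_min => /andP[].
  exact: cT.
Qed.

Section Ssyt.
Variables (m i : nat) (T : seq (seq nat)).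
Hypotheses (i0 : 0 < i) (TP : is_ssyt m T).

Lemma ssyt_size_row r r' : r <= r' -> size (row T r') <= size (row T r).
Proof.
have [/andP[pT _] _ _ _] := is_ssytP m T TP => rr'.
have [r'T|r'T] := ltnP r' (size T); last by rewrite [row T r']nth_default.
have rT := leq_ltn_trans rr' r'T.
have gT : transitive geq by move=> x y z xy zx; exact: leq_trans zx xy.
have := sorted_leq_nth gT leqnn 0 pT.
move=> /(_ r r'); rewrite !inE /shape size_map !(nth_map [::]) //; exact.
Qed.

Lemma ssyt_row r c c' : c <= c' -> c' < size (row T r) ->
  entry T r c <= entry T r c'.
Proof.
have [_ _ rT _] := is_ssytP m T TP; move=> /subnK <-.
elim: (c' - c) => // d IH; rewrite addSn => dT.
exact: leq_trans (IH (ltnW dT)) (rT _ _ dT).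
Qed.

Lemma ssyt_col r r' c : r < r' -> c < size (row T r') ->
  entry T r c < entry T r' c.
Proof.
have [_ _ _ cT] := is_ssytP m T TP; move=> /subnK <-.
elim: (r' - r.+1) => [|d IH].
  by rewrite add0n => c1; apply: cT => //; exact: leq_trans c1 (ssyt_size_row (leqnSn _)).
rewrite addSn => cd; have cd' := leq_trans cd (ssyt_size_row (leqnSn _)).
exact: ltn_trans (IH cd') (cT _ _ cd' cd).
Qed.

Lemma entry_in r c : 0 < entry T r c -> c < size (row T r).
Proof. by rewrite !ltnNge; apply: contra => /entry_out ->. Qed.

Lemma ssyt_col_lt r r' c : 0 < entry T r c ->
  entry T r c < entry T r' c -> r < r'.
Proof.
move=> e0 lt; rewrite ltnNge leq_eqVlt; apply/negP => /orP[/eqP e|lt'].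
  by move: lt; rewrite e ltnn.
by have := ssyt_col lt' (entry_in e0); rewrite ltnNge (ltnW lt).
Qed.

Lemma is_free_entry r c : is_free i T r c -> i <= entry T r c <= i.+1.
Proof. by case/andP; rewrite !inE => /orP[] /eqP -> _; rewrite leqnn ?leqnSn. Qed.

Lemma bk_entry_free r c : is_free i T r c -> i <= bk_entry i T r c <= i.+1.
Proof. by rewrite /bk_entry => ->; case: ifP => _; rewrite leqnn ?leqnSn. Qed.

Lemma bk_entry_fixed r c : ~~ is_free i T r c -> bk_entry i T r c = entry T r c.
Proof. by rewrite /bk_entry => /negbTE ->. Qed.

Lemma not_free_col r c : ~~ is_free i T r c -> i <= entry T r c <= i.+1 ->
  (i \in column T c) && (i.+1 \in column T c).
Proof.
rewrite negb_and negbK => /orP[|//]; rewrite !inE negb_or => /andP[n1 n2].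
rewrite leq_eqVlt eq_sym (negbTE n1) /= => /andP[l u].
by move: n2; rewrite eqn_leq l u.
Qed.

Lemma index_mono r c c' : c <= c' -> is_free i T r c -> is_free i T r c' ->
  index c (free_columns i T r) <= index c' (free_columns i T r).
Proof.
move=> cc' fc fc'; rewrite leqNgt; apply/negP => lt.
have st : sorted ltn (free_columns i T r).
  by apply: sorted_filter; [exact: ltn_trans|exact: iota_ltn_sorted].
have inF d : is_free i T r d -> d \in free_columns i T r.
  by move=> fd; rewrite mem_filter fd mem_iota add0n (is_free_in i0 fd).
have := sorted_ltn_index ltn_trans st _ _ (inF _ fc') (inF _ fc) lt.
by rewrite ltnNge cc'.
Qed.

Lemma is_ssyt_bk : i < m -> is_ssyt m (bk_rows i T).
Proof.
move=> im; have [pT bT rT cT] := is_ssytP m T TP.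
apply/is_ssytP; rewrite shape_bk; split=> // r c; rewrite ?size_row_bk ?entry_bk //.
- move=> rc; have [fr|fr] := boolP (is_free i T r c); last first.
    by rewrite bk_entry_fixed //; exact: bT.
  have /andP[l u] := bk_entry_free fr.
  by rewrite (leq_trans i0 l) (leq_trans u im).
- move=> rc; have le := rT r c rc.
  have [f1|f1] := boolP (is_free i T r c);
    have [f2|f2] := boolP (is_free i T r c.+1); last first.
  + by rewrite !bk_entry_fixed.
  + rewrite bk_entry_fixed //; have /andP[l _] := bk_entry_free f2.
    have [//|lt] := leqP (entry T r c) i; first by move=> ?; exact: leq_trans l.
    have /andP[_ u] := is_free_entry f2.
    have e1 : entry T r c = i.+1 by apply/eqP; rewrite eqn_leq lt (leq_trans le u).
    have e2 : entry T r c.+1 = i.+1 by apply/eqP; rewrite eqn_leq u -e1 le.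
    have /andP[/(mem_column _ _ i0)[r' e'] _] : (i \in column T c) && (i.+1 \in column T c).
      by apply: (not_free_col f1); rewrite e1 leqnn leqnSn.
    have r'r : r' < r by apply: (@ssyt_col_lt _ _ c); rewrite ?e1 e'.
    have rc' := leq_trans rc (ssyt_size_row (ltnW r'r)).
    have := ssyt_col r'r rc; rewrite e2 ltnS => ub.
    have lb := ssyt_row (leqnSn c) rc'; rewrite e' in lb.
    case/andP: f2 => _ /negP[]; apply/andP; split; apply/mem_column => //.
      by exists r'; apply/eqP; rewrite eqn_leq ub lb.
    by exists r.
  + rewrite [X in _ <= X]bk_entry_fixed //; have /andP[_ u] := bk_entry_free f1.
    have [lt|ge] := ltnP i (entry T r c.+1); first exact: leq_trans lt.
    have /andP[l _] := is_free_entry f1.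
    have e1 : entry T r c = i by apply/eqP; rewrite eqn_leq l (leq_trans le ge).
    have e2 : entry T r c.+1 = i by apply/eqP; rewrite eqn_leq ge -e1 le.
    have /andP[_ /(mem_column _ _ (ltn0Sn i))[r' e']] :
        (i \in column T c.+1) && (i.+1 \in column T c.+1).
      by apply: (not_free_col f2); rewrite e2 leqnn leqnSn.
    have rr' : r < r' by apply: (@ssyt_col_lt _ _ c.+1); rewrite e2 ?e'.
    have rc' : c.+1 < size (row T r') by apply: entry_in; rewrite e'.
    have := ssyt_col rr' (ltnW rc'); rewrite e1 => lb.
    have ub := ssyt_row (leqnSn c) rc'; rewrite e' in ub.
    case/andP: f1 => _ /negP[]; apply/andP; split; apply/mem_column => //.
      by exists r.
    by exists r'; apply/eqP; rewrite eqn_leq ub lb.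
  + rewrite /bk_entry f1 f2; have := index_mono (leqnSn c) f1 f2.
    case: ifP => // ge1; case: ifP => // lt2 le12.
    by rewrite (leq_ltn_trans le12 lt2) in ge1.
- move=> rc rc'; have lt := cT r c rc rc'.
  have both : i <= entry T r c <= i.+1 -> i <= entry T r.+1 c <= i.+1 ->
      (i \in column T c) && (i.+1 \in column T c).
    move=> /andP[l1 u1] /andP[l2 u2]; apply/andP; split; apply/mem_column => //.
      exists r; apply/eqP; rewrite eqn_leq l1 andbT -ltnS.
      exact: leq_trans lt u2.
    exists r.+1; apply/eqP; rewrite eqn_leq u2 /=.
    exact: leq_ltn_trans l1 lt.
  have [f1|f1] := boolP (is_free i T r c);
    have [f2|f2] := boolP (is_free i T r.+1 c); last first.
  + by rewrite !bk_entry_fixed.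
  + rewrite bk_entry_fixed //; have /andP[l _] := bk_entry_free f2.
    apply: leq_trans l; rewrite ltnNge; apply/negP => ge.
    case/andP: (f2) => _ /negP; apply; apply: both (is_free_entry f2).
    rewrite ge; have /andP[_ u] := is_free_entry f2.
    exact: ltnW (leq_trans lt u).
  + rewrite [X in _ < X]bk_entry_fixed //; have /andP[_ u] := bk_entry_free f1.
    apply: leq_ltn_trans u _; rewrite ltnNge; apply/negP => le.
    case/andP: (f1) => _ /negP; apply; apply: both (is_free_entry f1) _.
    rewrite le andbT; have /andP[l _] := is_free_entry f1.
    exact: leq_trans l (ltnW lt).
  + case/andP: (f2) => _ /negP[].
    exact: both (is_free_entry f1) (is_free_entry f2).
Qed.

Lemma is_free_bk r c : is_free i (bk_rows i T) r c = is_free i T r c.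
Proof.
have inE2 r' : (bk_entry i T r' c \in [:: i; i.+1]) = (entry T r' c \in [:: i; i.+1]).
  have [f|f] := boolP (is_free i T r' c); last by rewrite bk_entry_fixed.
  rewrite /bk_entry f; case/andP: f => -> _.
  by case: ifP => _; rewrite !inE eqxx ?orbT.
rewrite /is_free entry_bk // inE2; congr (_ && ~~ _).
apply/idP/idP => /andP[].
  move=> /(mem_column _ _ i0)[r1 e1] /(mem_column _ _ (ltn0Sn i))[r2 e2].
  rewrite !entry_bk // in e1 e2.
  have := inE2 r1; rewrite e1 !inE eqxx => /esym /orP i1.
  have := inE2 r2; rewrite e2 !inE eqxx orbT => /esym /orP i2.
  have r12 : r1 != r2.
    by apply/eqP => e; move: e2; rewrite -e e1 => /eqP; rewrite eqn_leq ltnn andbF.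
  have e12 : entry T r1 c != entry T r2 c.
    have p1 : 0 < entry T r1 c by case: i1 => /eqP ->.
    have p2 : 0 < entry T r2 c by case: i2 => /eqP ->.
    move: r12; rewrite !neq_ltn => /orP[/ssyt_col H|/ssyt_col H]; apply/orP.
      by left; apply: H; exact: entry_in.
    by right; apply: H; exact: entry_in.
  case: i1 i2 e12 => /eqP a1 [] /eqP a2; rewrite a1 a2 ?eqxx // => _.
    by apply/andP; split; apply/mem_column => //; [exists r1|exists r2].
  by apply/andP; split; apply/mem_column => //; [exists r2|exists r1].
move=> /[dup] h1 /(mem_column _ _ i0)[r1 e1].
move=> /[dup] h2 /(mem_column _ _ (ltn0Sn i))[r2 e2].
have nf r' : ~~ is_free i T r' c by rewrite /is_free h1 h2 andbF.
apply/andP; split; apply/mem_column => //.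
  by exists r1; rewrite entry_bk // bk_entry_fixed.
by exists r2; rewrite entry_bk // bk_entry_fixed.
Qed.

Lemma free_columns_bk r : free_columns i (bk_rows i T) r = free_columns i T r.
Proof.
by rewrite /free_columns size_row_bk; apply: eq_filter => c; exact: is_free_bk.
Qed.

Lemma free_succs_bk r :
  free_succs i (bk_rows i T) r = size (free_columns i T r) - free_succs i T r.
Proof.
rewrite {1}/free_succs free_columns_bk.
set s := free_columns i T r; set l := free_succs i T r.
have us : uniq s by rewrite filter_uniq ?iota_uniq.
have -> : count (fun c => entry (bk_rows i T) r c == i.+1) s
          = count (leq l) [seq index c s | c <- s].
  rewrite count_map; apply: eq_in_count => c /=; rewrite mem_filter => /andP[f _].
  rewrite entry_bk // /bk_entry f -/s -/l; case: ltnP => _; last by rewrite eqxx.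
  by rewrite eqn_leq ltnn andbF.
have -> : [seq index c s | c <- s] = iota 0 (size s).
  apply: (@eq_from_nth _ 0); rewrite size_map ?size_iota // => j js.
  by rewrite (nth_map 0) // nth_iota // index_uniq.
elim: (size s) => // k IH; rewrite -addn1 iotaD count_cat IH add0n /= addn0.
case: leqP => lk; first by rewrite /= !addn1 subSn.
by rewrite addn0 addn1; move: lk (ltnW lk); rewrite -!subn_eq0 => /eqP -> /eqP ->.
Qed.

Lemma free_entryE r c : is_free i T r c ->
  entry T r c = if index c (free_columns i T r)
                     < size (free_columns i T r) - free_succs i T r
                then i else i.+1.
Proof.
move=> f.
have two s : sorted leq s -> all (fun x => i <= x <= i.+1) s ->
    forall j, j < size s ->
    nth 0 s j = if j < size s - count (pred1 i.+1) s then i else i.+1.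
  elim: s => //= x s IH srt /andP[/andP[l u] ss] j js.
  have [lt|le] := ltnP i x.
    have ex : x = i.+1 by apply/eqP; rewrite eqn_leq u lt.
    have alls : all (pred1 i.+1) (x :: s).
      apply/allP => y ys /=; rewrite eqn_leq.
      have -> : y <= i.+1.
        by move: ys; rewrite inE => /predU1P[->|/(allP ss)/andP[]].
      move: ys; rewrite inE => /predU1P[->//|ys]; rewrite -ex.
      exact: (allP (order_path_min leq_trans srt)).
    have := alls; rewrite all_count /= => /eqP ->; rewrite subnn ltn0.
    by apply/eqP; exact: (all_nthP 0 alls).
  have ex : x = i by apply/eqP; rewrite eqn_leq le l.
  rewrite ex eqn_leq ltnn andbF add0n subSn ?count_size //.
  by case: j js => //= j js; rewrite ltnS IH // (path_sorted srt).
have inF : c \in free_columns i T r.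
  by rewrite mem_filter f mem_iota add0n (is_free_in i0 f).
rewrite -{1}(nth_index 0 inF); set s := free_columns i T r.
rewrite -(nth_map 0 0 (entry T r)) ?index_mem // two ?size_map ?index_mem //.
- by rewrite count_map.
- have srt : sorted ltn s.
    by apply: sorted_filter; [exact: ltn_trans|exact: iota_ltn_sorted].
  rewrite sorted_map; apply: sub_in_sorted srt => // a b.
  rewrite /s !mem_filter !mem_iota !add0n => _ /andP[_ /andP[_ bT]] ab.
  by apply: ssyt_row => //; exact: ltnW.
- rewrite all_map; apply/allP => d; rewrite mem_filter => /andP[fd _].
  exact: is_free_entry.
Qed.

Lemma bk_rowsK : bk_rows i (bk_rows i T) = T.
Proof.
have eqr r c : entry (bk_rows i (bk_rows i T)) r c = entry T r c.
  rewrite entry_bk // /bk_entry is_free_bk free_columns_bk free_succs_bk.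
  case: ifP => [f|f]; first by rewrite -free_entryE.
  by rewrite entry_bk // bk_entry_fixed ?f.
apply: (@eq_from_nth _ [::]); rewrite ?size_mkseq // => r rT.
apply: (@eq_from_nth _ 0) => [|c _]; last exact: eqr.
by rewrite -!/(row _ _) !size_row_bk.
Qed.

End Ssyt.
End BenderKnuthFacts.

(** [bk m i] is the identity unless 1 <= i < m, the only meaningful indices. *)
Definition bk_fun (m i : nat) (T : ssyt m) : seq (seq nat) :=
  if 0 < i < m then bk_rows i T else T.

Lemma bk_subproof m i (T : ssyt m) : is_ssyt m (bk_fun i T).
Proof.
rewrite /bk_fun; case: ifP => [/andP[i0 im]|_]; last exact: valP.
by apply: is_ssyt_bk => //; exact: valP.
Qed.

Definition bk (m i : nat) (T : ssyt m) : ssyt m := SSYT (bk_subproof i T).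

Lemma bkK m i : involutive (@bk m i).
Proof.
move=> T; apply: val_inj; rewrite /= /bk_fun /= /bk_fun.
case im: (0 < i < m); rewrite ?im //.
by have /andP[i0 _] := im; exact: bk_rowsK i0 (valP T).
Qed.

Local Open Scope group_scope.
Local Open Scope classical_set_scope.

Definition bk_perm (m i : nat) : permutation (ssyt m) :=
  involution_perm (@bkK m i).

Definition bk_subgroup (m : nat) : set (permutation (ssyt m)) :=
  generated [set bk_perm m i | i in [set i | (0 < i < m)%N]].

Arguments bk_subgroup : clear implicits.

Record BK (m : nat) := MkBK {
  BK_perm :> permutation (ssyt m);
  _ : BK_perm \in bk_subgroup m
}.

HB.instance Definition _ m := [isSub for @BK_perm m].
HB.instance Definition _ m := [Choice of BK m by <:].

Lemma bk_group_closed m :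
  group_closed (fun p : permutation (ssyt m) => p \in bk_subgroup m).
Proof.
have [H1 HM HV] := generatedP
  [set bk_perm m i | i in [set i | (0 < i < m)%N]].
split; first exact/mem_set.
move=> p q; rewrite !unfold_in => /set_mem Hp /set_mem Hq.
by apply: mem_set; apply: HM => //; exact: HV.
Qed.

HB.instance Definition _ m :=
  SubChoice_isSubGroup.Build _ _ (BK m) (@bk_group_closed m).

Lemma bk_perm_in m i : bk_perm m i \in bk_subgroup m.
Proof.
rewrite inE; have [im|im] := boolP (0 < i < m)%N.
  by move=> H [_]; apply; exists i.
have -> : bk_perm m i = 1.
  apply: permutation_ext => T; apply: val_inj => /=.
  by rewrite /bk_fun (negbTE im).
by have [] := generatedP [set bk_perm m i | i in [set i | (0 < i < m)%N]].
Qed.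

Section Elements.
Variable m : nat.

Definition bkt (i : nat) : BK m := MkBK (bk_perm_in m i).

(** [bkq1 i] is q_[1,i] = t_1 (t_2 t_1) ... (t_i t_(i-1) ... t_1). *)
Definition bkq1 (i : nat) : BK m :=
  \prod_(k <- iota 1 i) \prod_(l <- rev (iota 1 k)) bkt l.

(** [bkq j k] is q_[j,k], and is 1 when the interval [j, k] is empty. *)
Definition bkq (j k : nat) : BK m :=
  if (j <= k)%N then bkq1 k * bkq1 (k + 1 - j) * bkq1 k else 1.

(** [t_dual j] is the dual element with subscript j, that is the conjugate of
    t_(m-j) by q_[1,m-1]. *)
Definition t_dual (j : nat) : BK m :=
  bkq 1 (m - 1) * bkt (m - j) * bkq 1 (m - 1).

End Elements.

Section Virtual.
Variable n : nat.
Local Notation BK2n := (BK (2 * n)%N).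

Definition virtual_gens : set BK2n :=
  [set bkq _ 1 i * bkq _ (2 * n - i) (2 * n - 1)
    | i in [set i | (1 <= i < n)%N]]
  `|` [set bkq _ i (2 * n - i) | i in [set i | (1 <= i <= n)%N]].

Definition virtual_BK : set BK2n := generated virtual_gens.

(** [t_pair i] and [t_mid i] are the virtual symplectic Bender-Knuth involutions
    t_({i} u {2n-i}) and t_[n-i+1,n+i]; for i = 1 the second factor of [t_mid i]
    is q_[n+1,n-1] = 1. *)
Definition t_pair (i : nat) : BK2n := bkt _ i * t_dual _ (2 * n - i).

Definition t_mid (i : nat) : BK2n :=
  bkq _ (n - i + 1) (n + i - 1) * bkq _ (n - i + 2) (n + i - 2).

End Virtual.

Arguments virtual_gens : clear implicits.
Arguments virtual_BK : clear implicits.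

(* Main.v *)
Require Import Defs.
From mathcomp Require Import all_boot.
From mathcomp Require Import boolp classical_sets.
From mathcomp Require Import order ssralg ssrnum ssrint zify.

Set Implicit Arguments.
Unset Strict Implicit.
Unset Printing Implicit Defensive.

(** Write q_i for q_[1,i] and p_i for t_i t_(i-1) ... t_1, and let N = 2n - 1.

    Two families of relations are at work.  The first one follows formally
    from t_i^2 = 1 and from the commutation of t_i and t_j for |i - j| > 1:
    the q_i are involutions with p_i = q_(i-1) q_i, and conjugation by q_N
    reverses the intervals inside [1, N] ([bkq1_conj]).  A central interval is
    its own reversal, so the elements q_[n-i+1,n+i-1] commute with one another
    when nested ([bkq_centered]), and the products t_[n-i+1,n+i] of two
    consecutive ones telescope.

    The second one is the commutation of t_i with q_N t_j q_N for i + j < N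
    ([bkt_dual_commute]), which does not follow formally from the first.  It
    makes x |-> x (q_N x q_N) multiplicative on the subgroup generated by
    t_1, ..., t_(n-1); this map sends t_i and q_i to the two kinds of paired
    generators, and t_i and q_i are words in each other, so both families
    generate the same subgroup.

    The commutation is proved with the crystal lowering operators f_i.  In the
    coordinates given by the Gelfand-Tsetlin pattern of a tableau, t_i is a
    piecewise-linear toggle ([gtp_bk]) and f_i lowers one coordinate, in the
    row where a partial sum, the height, is maximal ([lowers]).  A computation
    with maxima of heights ([height_prom], [lowers_prom_toggle]) shows that
    t_(i+1) t_i carries f_(i+1) to f_i, while t_j commutes with f_i for
    |i - j| > 1 and t_1 exchanges f_1 and its inverse.  It follows that q_N
    carries f_i to the inverse of f_(N+1-i) ([reverses_bkq1]): it is the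
    Lusztig involution.  Hence q_N t_j q_N commutes with f_l for all l < N - j.
    The operators f_1, ..., f_k connect every tableau to a lowest one, and a
    lowest tableau is determined by its shape and its entries above k + 1
    ([lowest_uniq]); an element that commutes with f_1, ..., f_k therefore
    commutes with q_k as well, because the commutation of the two can be
    checked on lowest tableaux and carried back along the lowering steps
    ([respects_commute]). *)

(** * Toggles of interlacing rows *)

Section Toggle.
Variables a b c d : nat -> nat.

(** With a, b and c the rows of three consecutive levels of a Gelfand-Tsetlin
    pattern, this is the reflection of [b r] in the interval that interlacing
    allows; the row above the first one imposes no bound. *)
Definition toggle (a b c : nat -> nat) (r : nat) : nat :=
  (if r is r'.+1 then minn (a r') (c r) else c r) + maxn (a r) (c r.+1) - b r.

Definition dec (f : nat -> nat) (r s : nat) : nat := f s - (s == r).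

(** When f_(i+1) lowers row [r], the operator f_i acts on the image under
    t_(i+1) t_i in row [prom_row a c r]: the first toggle moves the lowered cell
    one row up exactly when [c r] is too large to be the bound inside [minn]. *)
Definition prom_row (a c : nat -> nat) (r : nat) : nat :=
  if r is r'.+1 then if c r <= a r' then r else r' else r.

Hypotheses (a_b : forall s, a s <= b s) (b_a : forall s, b s.+1 <= a s).
Hypotheses (b_c : forall s, b s <= c s).
Hypotheses (c_d : forall s, c s <= d s) (d_c : forall s, d s.+1 <= c s).
Variable r : nat.
(* These two inequalities say that the height of the middle rows b, c, d has
   a strict drop after row [r] and no drop before it. *)
Hypothesis low : b r + d r.+1 < c r + c r.+1.
Hypothesis high : if r is r'.+1 then c r' + c r <= d r + b r' else true.

Lemma toggle_dec_mid s :
  toggle a b (dec c r) s = dec (toggle a b c) (prom_row a c r) s.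
Proof.
rewrite /toggle /dec /prom_row.
have := a_b s; have := b_c s; have := d_c s; have := c_d s.+1.
have := b_a s; case: s => [|s] /=.
  by case: r low high => [|[|r']] lo hi /=; do ?case: ifP; lia.
have := b_a s; move: low high; have [<-|ns] := eqVneq s.+1 r.
  by rewrite /=; do ?case: ifP; lia.
have [<-|ns'] := eqVneq s.+2 r; first by rewrite /=; do ?case: ifP; lia.
by case: r ns ns' => [|r'] ns ns' /=; do ?case: ifP; lia.
Qed.

Lemma prom_row_spec (e := toggle a b c) (k := prom_row a c r) :
  (k == r) && (d r.+1 < e r) || (k.+1 == r) && (e k <= d r).
Proof.
rewrite {}/e {}/k /toggle /prom_row; have := a_b r; have := b_c r.
case: r low high => [|r'] lo hi /=; first by lia.
have := b_a r'; case: ifP => le; rewrite eqxx /=; first by lia.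
move: lo hi le; have := b_c r'; have := a_b r'; have := c_d r'.+2; case: (r') => [|u]; lia.
Qed.

(** The cell that f_(i+1) removes from level i + 1 is given back by the second
    toggle: the lowered row of level i changes exactly one of its bounds, in the
    direction that compensates, by [prom_row_spec]. *)
Lemma toggle_dec_top s :
  toggle (dec (toggle a b c) (prom_row a c r)) (dec c r) d s = toggle (toggle a b c) c d s.
Proof.
have e_strip u : c u.+1 <= toggle a b c u.
  rewrite /toggle; have := a_b u; have := b_c u; case: u => [|u]; first by lia.
  by have := b_a u; lia.
have := prom_row_spec; move: (toggle a b c) (prom_row a c r) e_strip => e k e_strip.
have c_r : 0 < c r by have := c_d r.+1; have := c_d r; move: low; lia.
have := c_d s; have := d_c s; have := e_strip s; rewrite /toggle /dec => es ds cs.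
case/orP => /andP[/eqP kr].
  move: kr c_r => -> c_r; move: c_r; case: s es ds cs => [|s] es ds cs.
    have [<-|ns] := eqVneq 0 r; lia.
  have := e_strip s.
  have [<-|ns] := eqVneq s.+1 r; first by lia.
  have [<-|ns'] := eqVneq s r; lia.
move: kr c_r => <-; case: s es ds cs => [|s] es ds cs.
  have [<-|ns] := eqVneq 0 k; lia.
have := e_strip s.
have [<-|ns] := eqVneq s.+1 k; first by lia.
have [<-|ns'] := eqVneq s k; lia.
Qed.

End Toggle.

(** * Gelfand-Tsetlin patterns of tableaux *)

Section GelfandTsetlin.

(** Level [j] of the Gelfand-Tsetlin pattern of [T]: the row lengths of the
    subtableau of entries at most [j]. *)
Definition gtp (T : seq (seq nat)) (j r : nat) : nat :=
  count (fun x => x <= j) (row T r).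

Lemma ltn_ext a b : (forall c, (c < a) = (c < b)) -> a = b.
Proof. by move=> ab; have := ab a; have := ab b; lia. Qed.

Lemma ltn_count_sorted s j c : sorted leq s ->
  (c < count (fun x => x <= j) s) = (c < size s) && (nth 0 s c <= j).
Proof.
elim: s c => [//|x s IH] c /=; case: (leqP x j) => [xj|jx] /= ps.
  by case: c => [//|c]; rewrite add1n ltnS IH // (path_sorted ps).
have s0 : count (fun x => x <= j) s = 0.
  apply/eqP; rewrite -leqn0 leqNgt -has_count; apply/hasPn => y ys.
  have /allP/(_ y ys) := order_path_min leq_trans ps => /=; lia.
rewrite s0 ltn0; case: c => [|c] /=; first by rewrite leqNgt jx.
have [cs|//] := ltnP c.+1 (size s).+1.
have /allP/(_ _ (mem_nth 0 cs)) := order_path_min leq_trans ps => /=; lia.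
Qed.

Variable m : nat.
Implicit Types T U : ssyt m.

Lemma ssytP T : is_ssyt m T. Proof. exact: valP. Qed.

Lemma ltn_gtp T j r c :
  (c < gtp T j r) = (c < size (row T r)) && (entry T r c <= j).
Proof.
apply: ltn_count_sorted; have [rT|rT] := ltnP r (size T); last first.
  by rewrite /row nth_default.
by have /and4P[_ _ /allP + _] := ssytP T; apply; exact: mem_nth.
Qed.

Lemma gtp0 T r : gtp T 0 r = 0.
Proof.
apply: ltn_ext => c; rewrite ltn_gtp ltn0; have [cT /=|//] := ltnP c (size (row T r)).
by have [_ /(_ r c cT) + _ _] := is_ssytP m T (ssytP T); lia.
Qed.

Lemma gtp_top T r : gtp T m r = size (row T r).
Proof.
apply: ltn_ext => c; rewrite ltn_gtp; have [cT /=|//] := ltnP c (size (row T r)).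
by have [_ /(_ r c cT) + _ _] := is_ssytP m T (ssytP T); lia.
Qed.

Lemma leq_gtp T j j' r : j <= j' -> gtp T j r <= gtp T j' r.
Proof. by move=> jj'; apply: sub_count => x /= xj; exact: leq_trans xj jj'. Qed.

Lemma gtp_strip T j r : gtp T j.+1 r.+1 <= gtp T j r.
Proof.
rewrite leqNgt; apply/negP; rewrite ltn_gtp => /andP[cT ej].
have lt := ssyt_col (ssytP T) (ltnSn r) cT.
have cT' := leq_trans cT (ssyt_size_row (ssytP T) (leqnSn r)).
by have := ltnn (gtp T j r); rewrite {1}ltn_gtp cT' /=; lia.
Qed.

Lemma gtp_high_row T j r : j <= r -> gtp T j r = 0.
Proof.
elim: j r => [|j IH] [|r] //; rewrite ?gtp0 // ltnS => jr.
by have := gtp_strip T j r; rewrite IH //; lia.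
Qed.

Lemma gtp_inj T U : (forall j r, j <= m -> gtp T j r = gtp U j r) -> T = U.
Proof.
move=> TU; have sTU r : size (row T r) = size (row U r) by rewrite -!gtp_top TU.
have size_row V r : (r < size (V : ssyt m)) = (0 < size (row V r)).
  have [/andP[_ V0] _ _ _] := is_ssytP m V (ssytP V).
  have [rV|rV] := ltnP r (size V); last by rewrite /row nth_default.
  rewrite lt0n; apply/esym/negP => /eqP sr0; case/negP: V0.
  by rewrite -sr0; apply: map_f; exact: mem_nth.
apply: val_inj; apply: (@eq_from_nth _ [::]) => [|r _].
  by apply: ltn_ext => r; rewrite !size_row sTU.
apply: (@eq_from_nth _ 0) => [|c cT]; first exact: sTU.
have le_entry j : j <= m -> (entry T r c <= j) = (entry U r c <= j).
  by move=> jm; have := ltn_gtp T j r c; rewrite TU // ltn_gtp -sTU cT /=.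
have [_ /(_ r c cT)/andP[_ Tm] _ _] := is_ssytP m T (ssytP T).
rewrite sTU in cT; have [_ /(_ r c cT)/andP[_ Um] _ _] := is_ssytP m U (ssytP U).
change (entry T r c = entry U r c); apply/eqP; rewrite eqn_leq.
by rewrite le_entry // leqnn -le_entry // leqnn.
Qed.

(** The entry in column c of row r has to be the least level j with
    [c < g j r]; interlacing makes this filling semistandard. *)
Lemma gtp_realize T (g : nat -> nat -> nat) :
    (forall r, g 0 r = 0) -> (forall r, g m r = gtp T m r) ->
    (forall j r, j < m -> g j r <= g j.+1 r) ->
    (forall j r, j < m -> g j.+1 r.+1 <= g j r) ->
  exists U, forall j r, j <= m -> gtp U j r = g j r.
Proof.
move=> g0 gm g_le g_strip.
have g_mono j j' r : j <= j' <= m -> g j r <= g j' r.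
  move=> /andP[/subnK <-]; elim: (j' - j) => // d IH dm.
  by apply: leq_trans (IH _) (g_le _ _ _); lia.
pose e r c := find (fun j => c < g j r) (iota 0 m.+1).
have eP r c j : c < g m r -> j <= m -> (e r c <= j) = (c < g j r).
  move=> cg jm; have he : has (fun j => c < g j r) (iota 0 m.+1).
    by apply/hasP; exists m => //; rewrite mem_iota; lia.
  have em : e r c < m.+1 by rewrite -[X in _ < X](size_iota 0) -has_find.
  apply/idP/idP => [ej|cj].
    have := nth_find 0 he; rewrite nth_iota // add0n -/(e r c) => ce.
    by apply: leq_trans ce (g_mono _ _ _ _); rewrite ej.
  rewrite leqNgt; apply/negP => je.
  by have := before_find 0 je; rewrite nth_iota ?add0n ?cj; lia.
pose S := mkseq (fun r => mkseq (e r) (size (row T r))) (size T).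
have sS r : size (row S r) = size (row T r).
  rewrite /row /S; have [rT|rT] := ltnP r (size T).
    by rewrite nth_mkseq // size_mkseq.
  by rewrite !nth_default // size_mkseq.
have eS r c : c < size (row S r) -> entry S r c = e r c.
  rewrite /entry sS => cS; have [rT|rT] := ltnP r (size T).
    by rewrite /row /S nth_mkseq // nth_mkseq.
  by move: cS; rewrite /row nth_default.
have shS : shape S = shape T.
  apply: (@eq_from_nth _ 0); rewrite /shape !size_map ?size_iota // => r rT.
  by rewrite !(nth_map [::]) ?size_map ?size_iota //; exact: sS.
have gS r : g m r = size (row S r) by rewrite gm gtp_top sS.
have e_gt0 r c : c < size (row S r) -> 0 < e r c.
  by move=> cS; rewrite ltnNge eP ?gS // g0.
have e_le r c : c < size (row S r) -> e r c <= m.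
  by move=> cS; rewrite eP ?gS.
have SP : is_ssyt m S.
  apply/is_ssytP; rewrite shS; split=> [|r c cS|r c cS|r c cS cS'].
  - by have [] := is_ssytP m T (ssytP T).
  - by rewrite eS // e_gt0 // e_le.
  - rewrite !eS // ?(ltnW cS) // eP ?gS ?(ltnW cS) ?e_le //.
    by apply: ltnW; rewrite -eP ?gS ?e_le.
  - rewrite !eS //; have := e_gt0 _ _ cS'; case k_e : (e r.+1 c) => [//|k] _.
    have km : k < m by rewrite -k_e e_le.
    rewrite ltnS eP ?gS //; last exact: ltnW.
    by apply: leq_trans (g_strip _ _ km); rewrite -eP ?gS // k_e.
exists (SSYT SP) => j r jm; apply: ltn_ext => c; rewrite ltn_gtp /=.
have [cS|Sc] := ltnP c (size (row S r)); first by rewrite eS // eP ?gS.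
by apply/esym/negbTE; rewrite -leqNgt; apply: leq_trans Sc; rewrite -gS g_mono ?jm //=.
Qed.

Lemma mem_entry_pair T i r c : 0 < i ->
  (entry T r c \in [:: i; i.+1]) = (gtp T i.-1 r <= c < gtp T i.+1 r).
Proof.
case: i => // i _; rewrite leqNgt !ltn_gtp !inE /=.
have [cT|Tc] := ltnP c (size (row T r)); first by lia.
by rewrite entry_out.
Qed.

(** Entries are strictly increasing down a column, so a companion of an entry
    i or i + 1 can only sit in the next cell below or above, and each of the two
    alternatives is a comparison with a neighbouring level. *)
Lemma pair_in_column T i r c : 0 < i -> entry T r c \in [:: i; i.+1] ->
  (i \in column T c) && (i.+1 \in column T c) =
  (c < gtp T i.+1 r.+1) || (if r is r'.+1 then gtp T i.-1 r' <= c else false).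
Proof.
move=> i0 eT; have e0 : 0 < entry T r c by move: eT; rewrite !inE; lia.
have cT := entry_in e0.
have [TP lt_col] := (ssytP T, fun r r' => @ssyt_col_lt m T (ssytP T) r r' c).
apply/idP/idP => [/andP[]|].
  move=> /(mem_column _ _ i0)[r1 e1] /(mem_column _ _ (ltn0Sn i))[r2 e2].
  have r12 : r1 < r2 by apply: lt_col; lia.
  have r2T : c < size (row T r2) by apply: entry_in; lia.
  have r21 : r2 = r1.+1.
    apply/eqP; rewrite eqn_leq r12 andbT leqNgt; apply/negP => r12'.
    have := ssyt_col TP r12' r2T.
    have := ssyt_col TP (ltnSn r1) (leq_trans r2T (ssyt_size_row TP r12)).
    by lia.
  have [r1r|r2r] : r1 = r \/ r2 = r.
    have inj r' : 0 < entry T r' c -> entry T r' c = entry T r c -> r' = r.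
      move=> e0' ee; case: (ltngtP r' r) => // lt.
        by have := ssyt_col TP lt cT; lia.
      by have := ssyt_col TP lt (entry_in e0'); lia.
    by move: eT; rewrite !inE => /orP[] /eqP ee; [left|right]; apply: inj; lia.
  - by rewrite ltn_gtp -r1r -r21 r2T e2 leqnn.
  - rewrite -r2r r21 orbC leqNgt ltn_gtp e1.
    have -> : (i <= i.-1) = false by lia.
    by rewrite andbF.
case/orP => [|].
  rewrite ltn_gtp => /andP[cT' le].
  have := ssyt_col TP (ltnSn r) cT' => lt.
  apply/andP; split; apply/mem_column => //; [exists r|exists r.+1];
    by move: eT; rewrite !inE; lia.
case: r eT e0 cT => // r eT e0 cT; rewrite leqNgt ltn_gtp.
have cT' := leq_trans cT (ssyt_size_row TP (leqnSn r)).
have := ssyt_col TP (ltnSn r) cT => lt; rewrite cT' /= -ltnNge => gtp.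
by apply/andP; split; apply/mem_column => //; [exists r|exists r.+1];
  move: eT; rewrite !inE; lia.
Qed.

Lemma is_freeE T i r c : 0 < i ->
  is_free i T r c =
  (maxn (gtp T i.-1 r) (gtp T i.+1 r.+1) <= c <
   (if r is r'.+1 then minn (gtp T i.-1 r') (gtp T i.+1 r) else gtp T i.+1 r)).
Proof.
move=> i0; rewrite /is_free; have [eT|eT] := boolP (entry T r c \in _).
  rewrite (pair_in_column i0 eT); move: eT; rewrite mem_entry_pair //.
  by case: r => [|r]; lia.
by move: eT; rewrite mem_entry_pair //; case: r => [|r]; lia.
Qed.

(** The free cells of row r fill the columns of the interval [lo, hi) that
    interlacing leaves to level i, and exchanging the numbers of free i and of
    free i + 1 reflects the end of the i in that interval. *)
Lemma gtp_bk T i j r : 0 < i < m ->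
  gtp (bk i T) j r =
  if j == i then toggle (gtp T i.-1) (gtp T i) (gtp T i.+1) r else gtp T j r.
Proof.
move=> im; have /andP[i0 _] := im; have TP := ssytP T.
pose lo := maxn (gtp T i.-1 r) (gtp T i.+1 r.+1).
pose hi := if r is r'.+1 then minn (gtp T i.-1 r') (gtp T i.+1 r) else gtp T i.+1 r.
have freeE c : is_free i T r c = (lo <= c < hi) by exact: is_freeE.
have [lo_i i_hi] : lo <= gtp T i r /\ gtp T i r <= hi.
  have i1 : i.-1.+1 = i by lia.
  have := leq_gtp T r (leq_pred i); have := gtp_strip T i r.
  have := leq_gtp T r (leqnSn i).
  rewrite /lo /hi; case: r {lo hi freeE} => [|r]; first by lia.
  by have := gtp_strip T i.-1 r; rewrite i1; lia.
have hiT : hi <= size (row T r).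
  have : gtp T i.+1 r <= size (row T r) by exact: count_size.
  by rewrite /hi; case: (r) => // r'; lia.
have colsE : free_columns i T r = iota lo (hi - lo).
  rewrite /free_columns (eq_filter freeE).
  have -> : size (row T r) = lo + (hi - lo) + (size (row T r) - hi) by lia.
  rewrite !iotaD !filter_cat !add0n.
  rewrite (@eq_in_filter _ _ pred0 (iota 0 lo)); last first.
    by move=> c; rewrite mem_iota /=; lia.
  rewrite (@eq_in_filter _ _ predT (iota lo _)); last first.
    by move=> c; rewrite mem_iota /=; lia.
  rewrite (@eq_in_filter _ _ pred0 (iota (lo + (hi - lo)) _)); last first.
    by move=> c; rewrite mem_iota /=; lia.
  by rewrite !filter_pred0 filter_predT cats0.
have indexE c : lo <= c < hi -> index c (free_columns i T r) = c - lo.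
  move=> c_lohi; have {1}-> : c = nth 0 (iota lo (hi - lo)) (c - lo).
    by rewrite nth_iota; lia.
  by rewrite colsE index_uniq ?iota_uniq // size_iota; lia.
have succsE : free_succs i T r = hi - gtp T i r.
  have le : free_succs i T r <= hi - lo.
    by rewrite -(size_iota lo (hi - lo)) -colsE; exact: count_size.
  suff : gtp T i r = hi - free_succs i T r by lia.
  apply: ltn_ext => c; have [c_lohi|] := boolP (lo <= c < hi); last by lia.
  rewrite ltn_gtp (free_entryE i0 TP); last by rewrite freeE.
  rewrite indexE // colsE size_iota.
  by case: ifP; lia.
have entryE c : c < size (row T r) -> entry (bk i T) r c =
    if lo <= c < hi then if c < lo + hi - gtp T i r then i else i.+1
    else entry T r c.
  move=> cT; rewrite /bk /= /bk_fun im entry_bk // /bk_entry freeE.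
  by case: ifP => // c_lohi; rewrite indexE // succsE; congr (if _ then _ else _); lia.
have sizeE : size (row (bk i T) r) = size (row T r).
  by rewrite /bk /= /bk_fun im size_row_bk.
apply: ltn_ext => c; rewrite ltn_gtp sizeE.
have -> : toggle (gtp T i.-1) (gtp T i) (gtp T i.+1) r = lo + hi - gtp T i r.
  by rewrite /toggle /lo /hi; lia.
have [cT|Tc] := ltnP c (size (row T r)); last first.
  by case: ifP => _; [lia|rewrite ltn_gtp; lia].
rewrite entryE //=; have [c_lohi|c_lohi] := boolP (lo <= c < hi).
  have /andP[eT _] : is_free i T r c by rewrite freeE.
  case: eqP => [->|ji]; first by case: ifP; lia.
  by move: eT; rewrite ltn_gtp cT !inE; case: ifP; lia.
case: eqP => [->|ji]; last by rewrite ltn_gtp cT.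
by have := ltn_gtp T i r c; rewrite cT /= => <-; lia.
Qed.

End GelfandTsetlin.

(** * Relations that follow from far commutation *)

Section Relations.
Local Open Scope group_scope.
Variable m : nat.
Local Notation t := (bkt m).
Local Notation q := (bkq1 m).

Lemma actM (x y : BK m) T : (x * y) T = x (y T). Proof. by []. Qed.

Lemma BK_ext (x y : BK m) : (forall T, x T = y T) -> x = y.
Proof. by move=> xy; apply: val_inj; apply: permutation_ext => T; apply: xy. Qed.

Lemma bktK i : t i * t i = 1.
Proof. by apply: BK_ext => T; rewrite actM; exact: bkK. Qed.

Lemma bkt_out i : ~~ (0 < i < m)%N -> t i = 1.
Proof.
by move=> im; apply: BK_ext => T; apply: val_inj; rewrite /= /bk_fun (negbTE im).
Qed.

Lemma bkt_far i j : (i.+1 < j)%N -> commute (t i) (t j).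
Proof.
move=> ij; have [im|/bkt_out->] := boolP (0 < i < m)%N; last first.
  exact/commute_sym/commute1.
have [jm|/bkt_out->] := boolP (0 < j < m)%N; last exact: commute1.
apply: BK_ext => T; apply: gtp_inj => l r _; rewrite !actM.
have gtp_t k (S : ssyt m) u : (0 < k < m)%N -> u != k -> gtp (t k S) u = gtp S u.
  by move=> km uk; apply/funext => s; rewrite gtp_bk // (negbTE uk).
have [->|li] := eqVneq l i.
  rewrite (gtp_t j) //; last by lia.
  by rewrite !(@gtp_bk m _ i i) // eqxx !gtp_t //; lia.
rewrite (gtp_t i) //; have [->|lj] := eqVneq l j; last by rewrite !gtp_t.
by rewrite !(@gtp_bk m _ j j) // eqxx !gtp_t //; lia.
Qed.

Definition bkp k : BK m := \prod_(l <- rev (iota 1 k)) t l.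

Lemma bkpS k : bkp k.+1 = t k.+1 * bkp k.
Proof. by rewrite /bkp -{1}(addn1 k) iotaD rev_cat big_cat /= big_seq1 add1n. Qed.

Lemma bkp0 : bkp 0 = 1. Proof. by rewrite /bkp big_nil. Qed.

Lemma bkq1S k : q k.+1 = q k * bkp k.+1.
Proof. by rewrite /bkq1 -{1}(addn1 k) iotaD big_cat /= big_seq1 add1n. Qed.

Lemma bkq1_0 : q 0 = 1. Proof. by rewrite /bkq1 big_nil. Qed.

Lemma commute_bkp (x : BK m) k :
  (forall i, (i <= k)%N -> commute x (t i)) -> commute x (bkp k).
Proof.
elim: k => [|k IH] xt; first by rewrite bkp0; exact: commute1.
by rewrite bkpS; apply: commuteM; [exact: xt|apply: IH => i ik; apply: xt; exact: leqW].
Qed.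

Lemma commute_bkq1 (x : BK m) k :
  (forall i, (i <= k)%N -> commute x (t i)) -> commute x (q k).
Proof.
elim: k => [|k IH] xt; first by rewrite bkq1_0; exact: commute1.
rewrite bkq1S; apply: commuteM; last exact: commute_bkp.
by apply: IH => i ik; apply: xt; exact: leqW.
Qed.

Lemma bkt_bkq1 i k : (k.+1 < i)%N -> commute (t i) (q k).
Proof.
move=> ki; apply: commute_bkq1 => j jk.
by apply/commute_sym/bkt_far; lia.
Qed.

(** Equivalently p_k q_(k-1) p_k = q_(k-1): removing t_k from both factors p_k
    leaves the previous case, since t_k commutes with q_(k-2). *)
Lemma bkp_bkq1 k : bkp k.+1 * q k.+1 = q k.
Proof.
elim: k => [|k IH]; first by rewrite bkq1S bkpS bkq1_0 bkp0 mulg1 mul1g bktK.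
by rewrite [q k.+2]bkq1S [bkp k.+2]bkpS !mulgA -[t k.+2 * _ * _]mulgA IH
     (bkt_bkq1 (leqnn k.+2)) -[q k * _ * _]mulgA bktK mulg1 bkq1S.
Qed.

Lemma bkq1K k : q k * q k = 1.
Proof.
elim: k => [|k IH]; first by rewrite bkq1_0 mulg1.
by rewrite {1}bkq1S -mulgA bkp_bkq1.
Qed.

Lemma bkq1KM k x : q k * (q k * x) = x.
Proof. by rewrite mulgA bkq1K mul1g. Qed.

Lemma bkq1V k : (q k)^-1 = q k.
Proof. by apply: (mulgI (q k)); rewrite mulgV bkq1K. Qed.

Lemma bkpE k : bkp k.+1 = q k * q k.+1.
Proof. by rewrite bkq1S mulgA bkq1K mul1g. Qed.

Lemma bkt_bkp i : t i.+1 = bkp i.+1 * (bkp i)^-1.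
Proof. by rewrite bkpS mulgK. Qed.

(** The element X = p_(N+1) p_(l+1)^-1 is a word in the t_j with j > l + 1, so it
    commutes with q_l and q_k, and q_(N+1) q_(l+1) = q_N X q_l. *)
Lemma bkq1_conjS N l k : (k <= l <= N)%N ->
  q N.+1 * (q l.+1 * q k * q l.+1) * q N.+1 = q N * (q l * q k * q l) * q N.
Proof.
move=> /andP[kl lN]; pose X := bkp N.+1 * (bkp l.+1)^-1.
have Xk j : (j <= l)%N -> commute X (t j).
  move=> jl; rewrite /X; move: lN => /subnK <-.
  elim: (N - l)%N => [|d IH]; first by rewrite mulgV; exact/commute_sym/commute1.
  rewrite addSn bkpS -mulgA; apply/commute_sym/commuteM; last exact/commute_sym.
  by apply: bkt_far; lia.
have qX : q N.+1 * q l.+1 = q N * X * q l.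
  apply: (mulgI (q N)); rewrite !mulgA bkq1K mul1g -bkpE /X -!mulgA; congr (_ * _).
  by rewrite -(bkp_bkq1 l) mulKg.
have qX' : q l.+1 * q N.+1 = q l * X^-1 * q N.
  by rewrite -[LHS]invgK invgM !bkq1V qX !invgM !bkq1V mulgA.
have XY : X * (q l * q k * q l) = q l * q k * q l * X.
  have Xq j : (j <= l)%N -> commute X (q j).
    by move=> jl; apply: commute_bkq1 => i ij; apply: Xk; lia.
  by apply: commuteM; [apply: commuteM|]; apply: Xq.
clearbody X; transitivity (q N * (X * (q l * q k * q l)) * X^-1 * q N).
  by rewrite !mulgA qX -!mulgA qX' !mulgA.
by rewrite XY !mulgA mulgK.
Qed.

(** Conjugation by q_N sends q_[l+1-k,l] to q_[N+1-l,N+k-l], the interval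
    reversed inside [1, N]. *)
Lemma bkq1_conj N l k : (k <= l <= N)%N ->
  q N * (q l * q k * q l) * q N = q (N - (l - k)) * q k * q (N - (l - k)).
Proof.
move=> /andP[kl lN]; have -> : N = (N - (l - k) + (l - k))%N by lia.
rewrite addnK; set M := (N - _)%N; have : (k <= M)%N by lia.
rewrite -[in q l](subnK kl); move: (l - k)%N => d kM {kl lN}.
elim: d => [|d IH]; first by rewrite addn0 bkq1K mul1g.
by rewrite addSn addnS bkq1_conjS ?IH; [|lia].
Qed.

Lemma bkqE j k : (0 < j <= k)%N -> bkq m j k = q k * q (k + 1 - j) * q k.
Proof. by rewrite /bkq => /andP[_ ->]. Qed.

Lemma bkqK j k : bkq m j k * bkq m j k = 1.
Proof.
rewrite /bkq; case: ifP => _; last exact: mulg1.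
by rewrite -!mulgA !bkq1KM bkq1K.
Qed.

(** Conjugation by q_a moves the inner interval [a-k, a-1] to [2, k+1] and the
    outer one [a-k-1, a] to [1, k+2]; there the inner interval is central, so it
    is fixed by the reversal. *)
Lemma bkq_centered a k : (k.+2 <= a)%N ->
  commute (q a * q k.+2 * q a) (q a.-1 * q k * q a.-1).
Proof.
move=> ka; set B := q a.-1 * q k * q a.-1; set C := q k.+1 * q k * q k.+1.
have BC : q a * B * q a = C.
  by rewrite /B bkq1_conj /C; [congr (q _ * _ * q _); lia|lia].
have CC : q k.+2 * C = C * q k.+2.
  apply: (mulIg (q k.+2)); rewrite -[RHS]mulgA bkq1K mulg1 bkq1_conj; last by lia.
  by congr (q _ * _ * q _); lia.
have aB : q a * B = C * q a by rewrite -BC -mulgA bkq1K mulg1.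
have Ba : B * q a = q a * C by rewrite -BC !mulgA bkq1K mul1g.
by clearbody B C; rewrite /commute -!mulgA aB !mulgA Ba -[_ * q k.+2 * C]mulgA CC !mulgA.
Qed.

End Relations.

(** * Lowering operators and their transport by two toggles *)

Section Crystal.
Variable m : nat.
Implicit Types T U V : ssyt m.
Local Open Scope ring_scope.

(** The number of i in rows r and below minus the number of i + 1 strictly below
    row r.  In the signature rule, where the rows are read from bottom to top and
    each i + 1 is matched with a later i, its maximum over r is the number of
    unmatched i. *)
Definition height T i r : int :=
  \sum_(r <= s < m) ((gtp T i s)%:Z - (gtp T i.-1 s)%:Z
                     - (gtp T i.+1 s.+1)%:Z + (gtp T i s.+1)%:Z).

Lemma height_out T i r : (m <= r)%N -> height T i r = 0.
Proof. by move=> mr; rewrite /height big_geq. Qed.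

Lemma height_rec T i r : (0 < i < m)%N ->
  height T i r = (gtp T i r)%:Z - (gtp T i.-1 r)%:Z - (gtp T i.+1 r.+1)%:Z
                 + (gtp T i r.+1)%:Z + height T i r.+1.
Proof.
move=> im; have [rm|mr] := ltnP r m; first by rewrite {1}/height big_ltn.
by rewrite !height_out ?gtp_high_row //; lia.
Qed.

Definition peak (h : nat -> int) r :=
  (forall s, h s <= h r) /\ (forall s, (r < s)%N -> h s < h r).

Lemma peak_uniq h r r' : peak h r -> peak h r' -> r = r'.
Proof.
move=> [hr pr] [hr' pr']; case: (ltngtP r r') => // lt.
  by have := pr _ lt; have := hr' r; lia.
by have := pr' _ lt; have := hr r'; lia.
Qed.

Lemma peak_exists h k : (forall r, (k <= r)%N -> h r = 0) ->
  (exists s, 0 < h s) -> exists r, peak h r.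
Proof.
move=> h0 [s hs].
have aux d : (d <= k)%N -> (forall r, (k - d <= r)%N -> h r <= 0) \/
    exists2 r, 0 < h r & (forall t, (k - d <= t)%N -> h t <= h r) /\
                         (forall t, (r < t)%N -> h t < h r).
  elim: d => [|d IH] dk.
    by left=> r; rewrite subn0 => kr; rewrite h0.
  have step (P : nat -> Prop) : P (k - d.+1)%N ->
      (forall t, (k - d <= t)%N -> P t) -> forall t, (k - d.+1 <= t)%N -> P t.
    move=> P0 PS t; rewrite leq_eqVlt => /predU1P[<-//|lt]; apply: PS; lia.
  have [le0|[r hr [le lt]]] := IH (ltnW dk).
    case: (boolP (h (k - d.+1)%N <= 0)) => hk; first by left; apply: step.
    right; exists (k - d.+1)%N; first (by lia); split.
      by apply: step => // t /le0; lia.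
    by move=> t lt; have := le0 t; lia.
  right; case: (boolP (h (k - d.+1)%N <= h r)) => hk.
    by exists r => //; split=> //; apply: step.
  exists (k - d.+1)%N; first by lia.
  split; first by apply: step => // t /le; lia.
  by move=> t kt; have := le t; lia.
have [|h_le0|[r _ [le lt]]] := aux k; first by [].
  by have := h_le0 s; rewrite subnn; lia.
by exists r; split=> // t; apply: le; rewrite subnn.
Qed.

(** The graph of the crystal lowering operator f_i: the last row of maximal
    height is the one that holds the last unmatched i in the reading order, and
    this i becomes i + 1. *)
Definition lowers i T U := (0 < i < m)%N /\
  exists2 r, peak (height T i) r &
    forall j s, gtp U j s = (gtp T j s - ((j == i) && (s == r)))%N.

Lemma lowers_fun i T U V : lowers i T U -> lowers i T V -> U = V.
Proof.
move=> [_ [r pr gU]] [_ [r' pr' gV]]; apply: gtp_inj => j s _.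
by rewrite gU gV (peak_uniq pr pr').
Qed.

Lemma peak_gt0 T i r : peak (height T i) r -> 0 < height T i r.
Proof. by move=> [_ /(_ (m + r.+1)%N)]; rewrite (@height_out _ _ (m + _)) ?leq_addr //; apply; lia. Qed.

Lemma gtp_above T j r : (m <= j)%N -> gtp T j r = gtp T m r.
Proof.
move=> mj; have := leq_gtp T r mj; have : (gtp T j r <= size (row T r))%N by exact: count_size.
by rewrite gtp_top; lia.
Qed.

(** The strict drop of the height after its peak leaves room to lower level i in
    that row without breaking interlacing. *)
Lemma lowers_exists T i s : (0 < i < m)%N -> 0 < height T i s ->
  exists U, lowers i T U.
Proof.
move=> im hs; have [|r pr] := @peak_exists (height T i) m (@height_out T i).
  by exists s.
have := pr.2 r.+1 (ltnSn r); rewrite (@height_rec T i r) // => lt.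
have b_c := leq_gtp T r.+1 (leq_pred i).
have i1 : i.-1.+1 = i by lia.
have := gtp_strip T i.-1 r; rewrite i1 => b_strip.
have d_strip := gtp_strip T i r; have c_d := leq_gtp T r.+1 (leqnSn i).
pose g j s := (gtp T j s - ((j == i) && (s == r)))%N.
have [||j t jm|j t jm|U gU] := @gtp_realize m T g.
- by move=> t; rewrite /g gtp0.
- by move=> t; rewrite /g; case: eqP => [|_]; [lia|rewrite subn0].
- rewrite /g; have [e|ne] := eqVneq j.+1 i; last first.
    by have := leq_gtp T t (leqnSn j); lia.
  have -> : j = i.-1 by lia.
  rewrite i1; have [->|ns] := eqVneq t r; first by lia.
  by have := leq_gtp T t (leq_pred i); lia.
- rewrite /g; have [->|ne] := eqVneq j i; last first.
    by have := gtp_strip T j t; lia.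
  have [->|ns] := eqVneq t r; first by lia.
  by have := gtp_strip T i t; lia.
exists U; split=> //; exists r => // j t.
have [jm|mj] := leqP j m; first exact: gU.
rewrite gtp_above ?gU ?(@gtp_above T j) /g; lia.
Qed.

Section Promotion.
Variables (i : nat) (T : ssyt m).
Hypotheses (i0 : (0 < i)%N) (im : (i.+1 < m)%N).
Let T1 := bk i T.
Let T2 := bk i.+1 T1.

Let i_m : (0 < i < m)%N. Proof. by lia. Qed.
Let Si_m : (0 < i.+1 < m)%N. Proof. by lia. Qed.
Let pred_i : i.-1.+1 = i. Proof. by lia. Qed.

Lemma gtp_prom_mid s :
  gtp T1 i s = toggle (gtp T i.-1) (gtp T i) (gtp T i.+1) s.
Proof. by rewrite gtp_bk // eqxx. Qed.

Lemma gtp_promE j s : gtp T2 j s =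
  if j == i.+1 then toggle (gtp T1 i) (gtp T i.+1) (gtp T i.+2) s
  else if j == i then gtp T1 i s else gtp T j s.
Proof.
have T1E k : k != i -> gtp T1 k = gtp T k.
  by move=> ki; apply/funext => u; rewrite gtp_bk // (negbTE ki).
rewrite gtp_bk //; case: eqP => [_|_] /=; first by rewrite !(T1E i.+1, T1E i.+2) //; lia.
by case: eqP => [->//|/eqP ji]; rewrite T1E.
Qed.

(** Once the two toggles are expanded, the terms min and max with equal arguments
    combine into sums; only the boundary terms at row r survive. *)
Lemma height_prom_sum r :
  height T2 i r = height T i.+1 r.+1 + (gtp T1 i r - gtp T i.+2 r.+1)%N%:Z
                  - (gtp T i.-1 r - gtp T i.+1 r.+1)%N%:Z.
Proof.
have [e_p e_i] : (forall s, gtp T2 i.-1 s = gtp T i.-1 s) /\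
    (forall s, gtp T2 i s = gtp T1 i s).
  split=> s; rewrite gtp_promE; first by rewrite !ifF //; lia.
  by rewrite eqxx ifF //; lia.
have e_Si s : gtp T2 i.+1 s = toggle (gtp T1 i) (gtp T i.+1) (gtp T i.+2) s.
  by rewrite gtp_promE eqxx.
have [k rk] : exists k, (m <= r + k)%N by exists m; lia.
elim: k r rk => [|k IH] r rk.
  rewrite !height_out; try lia.
  by rewrite !gtp_high_row; lia.
have c_strip : (gtp T i.+1 r.+1 <= gtp T1 i r)%N.
  by have := gtp_strip T1 i r; rewrite (gtp_bk T i.+1) // ifF //; lia.
have c_d := leq_gtp T r.+1 (leqnSn i.+1).
have b_a := gtp_strip T i.-1 r; rewrite pred_i in b_a.
have b_c := leq_gtp T r.+1 (leqnSn i).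
have := IH r.+1; rewrite (height_rec T2 r i_m) (height_rec T r.+1 Si_m) succnK.
rewrite !e_p !e_i e_Si /toggle (gtp_prom_mid r.+1) /toggle => ->; lia.
Qed.

(** In each row r > 0, one of the two corrections [gtp T i.+1 r - gtp T i.-1 r.-1]
    and [gtp T i.-1 r.-1 - gtp T i.+1 r] vanishes.  So every value of the height
    on level i + 1 reappears uncorrected in row r or r - 1, and both heights have
    the same maximum. *)
Lemma height_prom r :
  height T2 i r = Num.max
    (height T i.+1 r - (if r is r'.+1 then gtp T i.+1 r - gtp T i.-1 r' else 0)%N%:Z)
    (height T i.+1 r.+1 - (gtp T i.-1 r - gtp T i.+1 r.+1)%N%:Z).
Proof.
have b_c := leq_gtp T r (leqnSn i).
rewrite height_prom_sum (height_rec T r Si_m) gtp_prom_mid /toggle succnK.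
case: r b_c => [|r] b_c; first by lia.
by have := gtp_strip T i.-1 r; rewrite pred_i; lia.
Qed.

Lemma peak_prom r : peak (height T i.+1) r -> peak (height T2 i) (prom_row (gtp T i.-1) (gtp T i.+1) r).
Proof.
move=> [hr pr]; set k := prom_row _ _ r.
have le s : height T2 i s <= height T i.+1 r.
  by have := hr s; have := hr s.+1; rewrite height_prom; lia.
have lt s : (r < s)%N -> height T2 i s < height T i.+1 r.
  by move=> rs; have := pr s rs; have := pr s.+1 (leqW rs); rewrite height_prom; lia.
have eq : height T2 i k = height T i.+1 r /\
    (k = r \/ k.+1 = r /\ height T2 i r < height T i.+1 r).
  have := pr r.+1 (ltnSn r); have := hr k; move: (le k).
  have := height_prom r; have := height_prom r.-1.
  rewrite /k /prom_row; case: (r) => [|r'] /=; first by lia.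
  by case: ifP; lia.
case: eq => eq row; split=> s; first by rewrite eq.
rewrite eq; case: row => [->|[rE ltr]]; first exact: lt.
rewrite -ltnS rE leq_eqVlt => /orP[/eqP [<-]|]; last exact: lt.
by [].
Qed.

End Promotion.

Lemma lowers_prom_toggle i T U : (0 < i)%N -> lowers i.+1 T U ->
  lowers i (bk i.+1 (bk i T)) (bk i.+1 (bk i U)).
Proof.
move=> i0 [/andP[_ im] [r pr gU]]; split; first by lia.
exists (prom_row (gtp T i.-1) (gtp T i.+1) r); first exact: peak_prom.
have Si_m : (0 < i.+1 < m)%N by lia.
have pred_i : i.-1.+1 = i by lia.
have a_b s : (gtp T i.-1 s <= gtp T i s)%N by apply/leq_gtp/leq_pred.
have b_a s : (gtp T i s.+1 <= gtp T i.-1 s)%N by rewrite -{1}pred_i gtp_strip.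
have b_c s : (gtp T i s <= gtp T i.+1 s)%N by exact: leq_gtp.
have c_d s : (gtp T i.+1 s <= gtp T i.+2 s)%N by exact: leq_gtp.
have d_c s : (gtp T i.+2 s.+1 <= gtp T i.+1 s)%N by exact: gtp_strip.
have low : (gtp T i r + gtp T i.+2 r.+1 < gtp T i.+1 r + gtp T i.+1 r.+1)%N.
  by have := pr.2 r.+1 (ltnSn r); rewrite (height_rec T r Si_m) succnK; lia.
have high : is_true (if r is r'.+1 then
    (gtp T i.+1 r' + gtp T i.+1 r <= gtp T i.+2 r + gtp T i r')%N else true).
  case: (r) (pr.1 r.-1) => // r'; rewrite (height_rec T r' Si_m) !succnK; lia.
have U_other j : j != i.+1 -> gtp U j = gtp T j.
  by move=> ji; apply/funext => s; rewrite gU (negbTE ji) subn0.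
have U_Si : gtp U i.+1 = dec (gtp T i.+1) r.
  by apply/funext => s; rewrite gU eqxx.
have mid : gtp (bk i U) i = dec (gtp (bk i T) i) (prom_row (gtp T i.-1) (gtp T i.+1) r).
  apply/funext => s; rewrite gtp_prom_mid // U_Si !U_other; try lia.
  rewrite (toggle_dec_mid a_b b_a b_c c_d d_c low high) /dec gtp_prom_mid //.
have T_mid : gtp (bk i T) i = toggle (gtp T i.-1) (gtp T i) (gtp T i.+1).
  by apply/funext => s; rewrite gtp_prom_mid.
move=> j s; rewrite !gtp_promE //.
have [->|ji] := eqVneq j i.+1.
  have -> : (i.+1 == i) = false by lia.
  rewrite subn0 mid U_Si U_other ?T_mid; last by lia.
  exact: toggle_dec_top.
have [_|ji'] := eqVneq j i; first by rewrite mid.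
by rewrite U_other ?subn0.
Qed.

End Crystal.

(** * Partial Schuetzenberger involutions as Lusztig involutions *)

Section Lusztig.
Variable m : nat.
Implicit Types T U V S : ssyt m.

Lemma bk_out j T : ~~ (0 < j < m) -> bk j T = T.
Proof. by move=> jm; apply: val_inj; rewrite /= /bk_fun (negbTE jm). Qed.

Lemma gtp_bk_other j k T : k != j -> gtp (bk j T) k = gtp T k.
Proof.
move=> kj; have [jm|jm] := boolP (0 < j < m); last by rewrite bk_out.
by apply/funext => s; rewrite gtp_bk // (negbTE kj).
Qed.

(** In operator form, x f_i x^-1 = f_j. *)
Definition carries i j (x : BK m) :=
  forall T U, lowers i T U <-> lowers j (x T) (x U).

(** In operator form, x f_i x^-1 is the partial inverse of f_j. *)
Definition reverses i j (x : BK m) :=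
  forall T U, lowers i T U <-> lowers j (x U) (x T).

Local Notation t := (bkt m).
Local Notation q := (bkq1 m).
Local Open Scope group_scope.

Lemma bktE i T : t i T = bk i T. Proof. by []. Qed.

Lemma carriesM i j k x y : carries i j y -> carries j k x -> carries i k (x * y).
Proof. by move=> cy cx T U; rewrite !actM; split=> [/cy/cx|/cx/cy]. Qed.

Lemma reverses_carries i j k x y :
  carries i j y -> reverses j k x -> reverses i k (x * y).
Proof. by move=> cy cx T U; rewrite !actM; split=> [/cy/cx|/cx/cy]. Qed.

Lemma carries_reverses i j k x y :
  reverses i j y -> carries j k x -> reverses i k (x * y).
Proof. by move=> cy cx T U; rewrite !actM; split=> [/cy/cx|/cx/cy]. Qed.

Lemma reversesM i j k x y : reverses i j y -> reverses j k x -> carries i k (x * y).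
Proof. by move=> cy cx T U; rewrite !actM; split=> [/cy/cx|/cx/cy]. Qed.

Lemma carries1 i : carries i i 1. Proof. by []. Qed.

Lemma carries_invol i j (x : BK m) : x * x = 1 ->
  (forall T U, lowers i T U -> lowers j (x T) (x U)) ->
  (forall T U, lowers j T U -> lowers i (x T) (x U)) -> carries i j x.
Proof.
move=> xx ij ji T U; split; first exact: ij.
by move=> /ji; rewrite -!actM xx.
Qed.

Lemma carries_far i j : (i.+1 < j)%N || (j.+1 < i)%N -> carries i i (t j).
Proof.
move=> ij; suff far T U : lowers i T U -> lowers i (t j T) (t j U).
  by apply: carries_invol => //; exact: bktK.
move=> [im [r pr gU]]; split=> //; exists r.
  have -> // : height (t j T) i = height T i.
  by apply/funext => s; apply: eq_bigr => u _; rewrite !gtp_bk_other //; lia.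
have Uk k : k != i -> gtp U k = gtp T k.
  by move=> ki; apply/funext => s; rewrite gU (negbTE ki) subn0.
move=> k s; have [->|kj] := eqVneq k j; last by rewrite !gtp_bk_other.
have -> : (j == i) = false by lia.
rewrite subn0 !bktE; have [jm|jm] := boolP (0 < j < m)%N; last by rewrite !bk_out // Uk //; lia.
by rewrite !gtp_bk // eqxx !Uk //; lia.
Qed.

(** The converse of [lowers_prom_toggle] needs only that f_(i+1) is defined on T
    as soon as f_i is defined on its image; the maximal heights agree. *)
Lemma carries_prom i : (0 < i)%N -> (i.+1 < m)%N -> carries i.+1 i (t i.+1 * t i).
Proof.
move=> i0 im T U; rewrite !actM; split; first exact: lowers_prom_toggle.
move=> low; have [_ [r /peak_gt0 hr _]] := low.
have [V TV] : exists V, lowers i.+1 T V.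
  move: hr; rewrite height_prom // => hr.
  have [h1|h1] := boolP (0 < height T i.+1 r)%R; first by apply: lowers_exists h1; lia.
  by apply: (@lowers_exists _ _ _ r.+1); lia.
have := lowers_fun low (lowers_prom_toggle i0 TV).
by move=> /(can_inj (@bkK m _))/(can_inj (@bkK m _)) ->.
Qed.

(** Entries 1 occur in the first row only, and entries 2 in the first two. *)
Lemma height_one T r : (1 < m)%N ->
  height T 1 r = if r is 0 then ((gtp T 1 0)%:Z - (gtp T 2 1)%:Z)%R else 0%R.
Proof.
move=> m1; have h0 s : (0 < s)%N -> height T 1 s = 0%R.
  move=> s0; rewrite /height big_nat_cond big1 // => u /andP[/andP[su _] _].
  by rewrite !gtp_high_row //; lia.
case: r => [|r]; last exact: h0.
by rewrite height_rec // h0 // gtp0 (@gtp_high_row _ T 1 1) //; lia.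
Qed.

Lemma reverses_one : (1 < m)%N -> reverses 1 1 (t 1).
Proof.
move=> m1; have rev T U : lowers 1 T U -> lowers 1 (t 1 U) (t 1 T).
  move=> [_ [r pr gU]]; split=> //.
  have r0 : r = 0%N by have := peak_gt0 pr; rewrite height_one //; case: (r).
  move: pr gU; rewrite {}r0 => pr gU.
  have := peak_gt0 pr; rewrite height_one // => hr.
  have c_b := leq_gtp T 0 (leqnSn 1).
  have U2 : gtp U 2 = gtp T 2 by apply/funext => s; rewrite gU subn0.
  have Ts V s : gtp (t 1 V) 1 s = toggle (gtp V 0) (gtp V 1) (gtp V 2) s.
    by rewrite gtp_bk.
  exists 0%N.
    split=> [s|s s0]; rewrite !height_one // (@gtp_bk_other 1%N 2%N U) // Ts U2 /toggle !gtp0 gU.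
      by case: s => [|s]; lia.
    by case: s s0 => // s _; lia.
  move=> j s; have [->|j1] := eqVneq j 1%N; last first.
    by rewrite !gtp_bk_other // gU (negbTE j1) !subn0.
  rewrite !Ts U2 /toggle !gtp0 gU; case: s => [|s]; first by lia.
  have := gtp_strip T 1 s.+1; have := gtp_strip T 0 s; rewrite !gtp0; lia.
move=> T U; split; first exact: rev.
by move=> /rev; rewrite -!actM bktK.
Qed.

Lemma carries_bkp_far i k : (k.+1 < i)%N -> carries i i (bkp m k).
Proof.
elim: k => [|k IH] ki; first by rewrite bkp0; exact: carries1.
rewrite bkpS; apply: carriesM (IH _) (carries_far _); lia.
Qed.

Lemma carries_bkp i k : (0 < i < k)%N -> (k < m)%N -> carries i.+1 i (bkp m k).
Proof.
move=> /andP[i0 /subnK <-]; elim: (k - i.+1)%N => [|d IH] km.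
  case: i i0 km => // i _ im; rewrite add0n 2!bkpS mulgA.
  by apply: carriesM (carries_bkp_far _) (carries_prom _ _).
by rewrite addSn bkpS; apply: carriesM (IH _) (carries_far _); lia.
Qed.

(** For i > 1, the factor p_k of q_k = q_(k-1) p_k carries f_i to f_(i-1), and
    induction applies.  For i = 1, q_k is written p_k^-1 q_(k-1) instead. *)
Lemma reverses_bkq1 i k : (0 < i <= k)%N -> (k < m)%N -> reverses i (k.+1 - i) (q k).
Proof.
elim: k i => [|k IH] i ik km; first by lia.
have [k0|k0] := posnP k.
  have -> : i = 1%N by lia.
  by rewrite k0 in km *; rewrite bkq1S bkpS bkq1_0 bkp0 mul1g mulg1; exact: reverses_one.
case: i ik => // -[_|i ik].
  move=> T U; rewrite subn1 /=.
  have := carries_bkp (i := k) (k := k.+1); rewrite k0 ltnSn => /(_ isT km) ->.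
  rewrite -!actM bkp_bkq1.
  by have := IH 1%N; rewrite subn1 /=; apply; lia.
rewrite bkq1S subSS; apply: (reverses_carries (carries_bkp _ _)); try lia.
by apply: IH; lia.
Qed.

Definition lowest k T := forall i U, (0 < i <= k)%N -> ~ lowers i T U.

Inductive reach k : ssyt m -> ssyt m -> Prop :=
| reach_refl T : reach k T T
| reach_step i T U S : (0 < i <= k)%N -> lowers i T U -> reach k U S -> reach k T S.

Definition weight T := (\sum_(j < m) \sum_(r < m) gtp T j r)%N.

Lemma lowers_weight i T U : lowers i T U -> (weight U < weight T)%N.
Proof.
move=> [im [r pr gU]]; have [i0 i_m] := andP im.
have T_r : (0 < gtp T i r)%N.
  have := pr.2 r.+1 (ltnSn r); rewrite (height_rec T r im).
  have := leq_gtp T r (leq_pred i); have := leq_gtp T r.+1 (leqnSn i); lia.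
have rm : (r < m)%N.
  by rewrite ltnNge; apply/negP => mr; move: T_r; rewrite gtp_high_row //; lia.
have le j s : (gtp U j s <= gtp T j s)%N by rewrite gU leq_subr.
rewrite /weight (bigD1 (Ordinal i_m)) //= [X in (_ < X)%N](bigD1 (Ordinal i_m)) //=.
rewrite -addSn; apply: leq_add; last first.
  by apply: leq_sum => j _; apply: leq_sum => s _; exact: le.
rewrite (bigD1 (Ordinal rm)) //= [X in (_ < X)%N](bigD1 (Ordinal rm)) //=.
rewrite -addSn; apply: leq_add; last by apply: leq_sum => s _; exact: le.
by rewrite gU !eqxx subn1 prednK.
Qed.

Lemma reach_lowest k T : exists2 S, reach k T S & lowest k S.
Proof.
have [w] := ubnP (weight T); elim: w T => // w IH T Tw.
have [Tk|/existsNP[i /existsNP[U /not_implyP[ik /contrapT TU]]]] := pselect (lowest k T).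
  by exists T => //; exact: reach_refl.
have [|S US Sk] := IH U; first by have := lowers_weight TU; lia.
by exists S => //; exact: reach_step ik TU US.
Qed.

(** Where no f_i with i <= k is defined, the heights are at most 0, whereas by
    induction on the level they are sums of the nonnegative gaps
    [gtp T i s - gtp T i.+1 s.+1]; all the gaps therefore vanish. *)
Lemma lowest_gtp k T i s : (k < m)%N -> lowest k T -> (i <= k)%N ->
  gtp T i s = gtp T i.+1 s.+1.
Proof.
move=> km Tk; elim: i s => [|i IH] s ik.
  by rewrite !gtp_high_row.
have im : (0 < i.+1 < m)%N by lia.
have h_le0 r : (height T i.+1 r <= 0)%R.
  have [h|h] := boolP (0 < height T i.+1 r)%R; last by lia.
  by have [U /Tk[]] := lowers_exists im h; lia.
have h_ge0 r : (0 <= height T i.+1 r)%R.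
  apply: Num.Theory.sumr_ge0 => u _ /=.
  by rewrite IH; [have := gtp_strip T i.+1 u; lia|lia].
have := h_le0 s; have := h_ge0 s.+1; rewrite (height_rec T s im) /= IH; last by lia.
by have := gtp_strip T i.+1 s; lia.
Qed.

Lemma lowest_uniq k T S : (k < m)%N -> lowest k T -> lowest k S ->
  (forall j, (k < j)%N -> gtp T j = gtp S j) -> T = S.
Proof.
move=> km Tk Sk TS; apply: gtp_inj => j s _.
have [d kd] : exists d, (k < j + d)%N by exists k.+1; lia.
elim: d j s kd => [|d IH] j s kd; first by rewrite TS //; lia.
have [jk|kj] := leqP j k; last by rewrite TS.
by rewrite (lowest_gtp _ km Tk) // (lowest_gtp _ km Sk) // IH //; lia.
Qed.

Definition respects k (x : BK m) := forall i, (0 < i <= k)%N -> carries i i x.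

Lemma lowest_respects k (x : BK m) T : respects k x -> lowest k T -> lowest k (x T).
Proof.
move=> xk Tk i U ik; have -> : U = x (x^-1 U) by rewrite -actM mulgV.
by move=> /(xk i ik _ _).2; exact: Tk.
Qed.

Lemma reach_respects k (x : BK m) T S : respects k x -> reach k T S -> reach k (x T) (x S).
Proof.
move=> xk; elim=> [V|i V U W ik VU _ IH]; first exact: reach_refl.
exact: (reach_step ik ((xk i ik _ _).1 VU) IH).
Qed.

Lemma reach_gtp k T S j : reach k T S -> (k < j)%N -> gtp T j = gtp S j.
Proof.
move=> TS kj; elim: TS => // i V U W ik [_ [r _ gU]] _ <-.
have ji : (j == i) = false by lia.
by apply/funext => s; rewrite gU ji subn0.
Qed.

Lemma gtp_bkp k j T : (k < j)%N -> gtp (bkp m k T) j = gtp T j.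
Proof.
elim: k T => [|k IH] T kj; first by rewrite bkp0.
by rewrite bkpS actM gtp_bk_other ?IH //; lia.
Qed.

Lemma gtp_bkq1 k j T : (k < j)%N -> gtp (q k T) j = gtp T j.
Proof.
elim: k T => [|k IH] T kj; first by rewrite bkq1_0.
by rewrite bkq1S actM IH ?gtp_bkp //; lia.
Qed.

(** [T] and [q k T] are connected to the same lowest tableau, and x transports
    the two chains of lowering steps, none of which affects a level above k. *)
Lemma gtp_respects k (x : BK m) T j : (k < m)%N -> respects k x -> (k < j)%N ->
  gtp (x (q k T)) j = gtp (x T) j.
Proof.
move=> km xk kj.
have [[S TS Sk] [S' TS' Sk']] := (reach_lowest k T, reach_lowest k (q k T)).
have SS' : S = S'.
  apply: (lowest_uniq km Sk Sk') => l kl.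
  by rewrite -(reach_gtp TS kl) -(reach_gtp TS' kl) gtp_bkq1.
rewrite (reach_gtp (reach_respects xk TS) kj) SS'.
by rewrite (reach_gtp (reach_respects xk TS') kj).
Qed.

(** The maps q_k x and x q_k both turn f_i into the inverse of f_(k+1-i), so if
    they agree on the end of a lowering step they agree on its start.  On a lowest
    tableau S, q_k x q_k S and x S are lowest and agree above level k. *)
Lemma respects_commute k (x : BK m) : (k < m)%N -> respects k x -> commute x (q k).
Proof.
move=> km xk; apply: BK_ext => T; rewrite !actM.
have [S TS Sk] := reach_lowest k T.
elim: TS Sk => {T S} [S|i T U S ik TU _ IH] Sk.
  have qxq : respects k (q k * x * q k).
    move=> i ik; have ik' : (0 < k.+1 - i <= k)%N by lia.
    rewrite -mulgA; apply: (@reversesM _ (k.+1 - i)%N).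
      by apply: carries_reverses (reverses_bkq1 ik km) (xk _ ik').
    have {2}-> : i = (k.+1 - (k.+1 - i))%N by lia.
    exact: reverses_bkq1.
  have eq : (q k * x * q k) S = x S.
    apply: (lowest_uniq km); [exact: lowest_respects..|].
    by move=> j kj; rewrite !actM gtp_bkq1 // gtp_respects.
  by rewrite -eq -!actM !mulgA bkq1K mul1g.
have ik' : (0 < k.+1 - i <= k)%N by lia.
have /(xk _ ik') := (reverses_bkq1 ik km T U).1 TU.
have := (reverses_bkq1 ik km _ _).1 ((xk _ ik _ _).1 TU).
by rewrite IH // => low low'; exact: lowers_fun low' low.
Qed.

(** The word t_i is a product of elements q_k with k <= i, and q_N t_j q_N
    commutes with f_l for l <= i: conjugation by q_N turns f_l into the inverse
    of f_(N+1-l), where N + 1 - l > j + 1. *)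
Lemma bkt_dual_commute N i j : (N < m)%N -> (i + j < N)%N ->
  commute (t i) (q N * t j * q N).
Proof.
move=> Nm ijN; set x := q N * t j * q N.
have xq k : (k <= i)%N -> commute (q k) x.
  move=> ki; apply/commute_sym/respects_commute; first by lia.
  move=> l lk; rewrite /x -mulgA; apply: (@reversesM _ (N.+1 - l)%N).
    apply: carries_reverses; first by apply: reverses_bkq1; lia.
    by apply: carries_far; lia.
  have {2}-> : l = (N.+1 - (N.+1 - l))%N by lia.
  by apply: reverses_bkq1; lia.
have xp k : (k <= i)%N -> commute x (bkp m k).
  case: k => [|k] ki; first by rewrite bkp0; exact: commute1.
  by rewrite bkpE; apply: commuteM; apply/commute_sym/xq; lia.
apply/commute_sym; case: i {ijN xq} xp => [|i] xp.
  by rewrite bkt_out //; exact: commute1.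
by rewrite bkt_bkp; apply: commuteM; [|apply: commuteV]; apply: xp.
Qed.

End Lusztig.

(** * Generators of the virtual symplectic group *)

Section Generation.
Local Open Scope group_scope.
Local Open Scope classical_set_scope.

Lemma generated_eq (G : groupType) (S S' : set G) :
    (forall x, S x -> generated S' x) -> (forall x, S' x -> generated S x) ->
  generated S = generated S'.
Proof.
move=> SS' S'S; apply/seteqP; split; apply: smallest_sub => //;
  exact: generatedP.
Qed.

Lemma mem_generated (G : groupType) (S : set G) x : S x -> generated S x.
Proof. exact: sub_gen_smallest. Qed.

Variable n : nat.
Local Notation N := (2 * n - 1)%N.
Local Notation t := (bkt (2 * n)).
Local Notation p := (bkp (2 * n)).
Local Notation q := (bkq1 (2 * n)).

(** For x generated by t_1, ..., t_(n-1), this is the product of x with its image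
    under the reversal of [1, N]. *)
Definition twin (x : BK (2 * n)) : BK (2 * n) := x * (q N * x * q N).

Lemma twinM x y : commute y (q N * x * q N) -> twin (x * y) = twin x * twin y.
Proof.
move=> xy; rewrite /twin -!mulgA; congr (_ * _).
rewrite [RHS](_ : _ = (q N * x * q N * y) * (q N * (y * q N))); last by rewrite !mulgA.
by rewrite -xy -!mulgA bkq1KM.
Qed.

Lemma conj_commute (x y : BK (2 * n)) :
  commute x (q N * y * q N) -> commute (q N * x * q N) y.
Proof.
rewrite /commute => xy; transitivity (q N * (x * (q N * y * q N)) * q N).
  by rewrite -!mulgA bkq1K mulg1.
by rewrite xy -!mulgA bkq1KM.
Qed.

Lemma bkt_twin i j : (i < n)%N -> (j < n)%N -> commute (t i) (q N * t j * q N).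
Proof. by move=> i_n j_n; apply: bkt_dual_commute; lia. Qed.

Lemma bkp_twin i j : (i < n)%N -> (j < n)%N -> commute (p j) (q N * t i * q N).
Proof.
move=> i_n j_n; apply/commute_sym/commute_bkp => k kj.
by apply/commute_sym/bkt_twin => //; lia.
Qed.

Lemma twin_bkpS j : (j.+1 < n)%N -> twin (p j.+1) = twin (t j.+1) * twin (p j).
Proof. by move=> jn; rewrite bkpS; apply/twinM/bkp_twin => //; lia. Qed.

Lemma twin_bkq1S j : (j.+1 < n)%N -> twin (q j.+1) = twin (q j) * twin (p j.+1).
Proof.
move=> jn; rewrite bkq1S; apply/twinM/commute_sym/conj_commute/commute_sym.
by apply: commute_bkq1 => i ij; apply/conj_commute/bkp_twin => //; lia.
Qed.

Lemma twin1 : twin 1 = 1. Proof. by rewrite /twin mulg1 bkq1K mul1g. Qed.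

Lemma twin_generated (S : set (BK (2 * n))) :
  (forall i, (0 < i < n)%N -> generated S (twin (t i))) ->
  forall i, (i < n)%N -> generated S (twin (q i)).
Proof.
have [S1 SM _] := generatedP S; move=> St.
have Sp i : (i < n)%N -> generated S (twin (p i)).
  elim: i => [|i IH] i_n; first by rewrite bkp0 twin1.
  by rewrite twin_bkpS //; apply: SM; [apply: St|apply: IH; lia].
elim=> [|i IH] i_n; first by rewrite bkq1_0 twin1.
by rewrite twin_bkq1S //; apply: SM; [apply: IH; lia|apply: Sp].
Qed.

Lemma generated_twin (S : set (BK (2 * n))) :
  (forall i, (0 < i < n)%N -> generated S (twin (q i))) ->
  forall i, (0 < i < n)%N -> generated S (twin (t i)).
Proof.
have [S1 SM SV] := generatedP S; move=> Sq.
have Sq0 i : (i < n)%N -> generated S (twin (q i)).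
  by case: i => [|i] i_n; [rewrite bkq1_0 twin1|apply: Sq].
have Sp i : (i < n)%N -> generated S (twin (p i)).
  case: i => [|i] i_n; first by rewrite bkp0 twin1.
  rewrite -[twin _](mulKg (twin (q i))) -twin_bkq1S //.
  by apply: SM; [apply: SV|]; apply: Sq0; lia.
case=> // i /andP[_ i_n].
rewrite -[twin _](mulgK (twin (p i))) -twin_bkpS //.
by apply: SM; [|apply: SV]; apply: Sp; lia.
Qed.

Lemma t_pairE i : (i < n)%N -> t_pair n i = twin (t i).
Proof.
move=> i_n; rewrite /t_pair /t_dual /twin /bkq ifT; last by lia.
by rewrite addnK bkq1K mul1g subKn //; lia.
Qed.

Lemma bkq_prefix k : (0 < k)%N -> bkq (2 * n) 1 k = q k.
Proof. by move=> k0; rewrite bkqE // addnK bkq1K mul1g. Qed.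

Lemma virtual_genE i : (0 < i < n)%N ->
  bkq (2 * n) 1 i * bkq (2 * n) (2 * n - i) N = twin (q i).
Proof.
move=> i_n; rewrite bkq_prefix; last by lia.
by rewrite bkqE /twin; [congr (_ * (_ * q _ * _)); lia|lia].
Qed.

(** For i = 0 the interval is empty and the value is 1, so that [t_mid n 1] obeys
    the same formula as the others. *)
Definition central i := bkq (2 * n) (n - i + 1) (n + i - 1).

Lemma t_midE i : (0 < i <= n)%N -> t_mid n i = central i * central i.-1.
Proof.
case: i => // i i_n; rewrite /t_mid /central; congr (_ * bkq _ _ _); lia.
Qed.

Lemma central0 : central 0 = 1.
Proof. by rewrite /central /bkq ifF //; lia. Qed.

Lemma central_commute i : (0 < i <= n)%N -> commute (central i) (central i.-1).
Proof.
case: i => [//|[|i]] i_n; first by rewrite central0; exact: commute1.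
rewrite /central !bkqE; try lia.
have -> : (n + i.+2 - 1 + 1 - (n - i.+2 + 1) = (i + i).+1.+2)%N by lia.
have -> : (n + i.+1 - 1 + 1 - (n - i.+1 + 1) = (i + i).+1)%N by lia.
have -> : (n + i.+1 - 1 = (n + i.+2 - 1).-1)%N by lia.
by apply: bkq_centered; lia.
Qed.

Lemma virtual_mid i : (0 < i <= n)%N ->
  bkq (2 * n) i (2 * n - i) = central (n + 1 - i).
Proof. by move=> i_n; rewrite /central; congr bkq; lia. Qed.

End Generation.
Local Open Scope group_scope.
Local Open Scope classical_set_scope.

Theorem proposition10 (n : nat) (hn : (1 <= n)%N) :
  [/\ forall i : nat, (1 <= i < n)%N ->
        bkt (2 * n) i * t_dual (2 * n) (2 * n - i)
        = t_dual (2 * n) (2 * n - i) * bkt (2 * n) i,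
      forall i : nat, (1 <= i <= n)%N ->
        bkq (2 * n) (n - i + 1) (n + i - 1) * bkq (2 * n) (n - i + 2) (n + i - 2)
        = bkq (2 * n) (n - i + 2) (n + i - 2) * bkq (2 * n) (n - i + 1) (n + i - 1),
      forall i : nat, (1 <= i < n)%N -> t_pair n i * t_pair n i = 1,
      forall i : nat, (1 <= i <= n)%N -> t_mid n i * t_mid n i = 1
    & generated ([set t_pair n i | i in [set i | (1 <= i < n)%N]]
                 `|` [set t_mid n i | i in [set i | (1 <= i <= n)%N]])
      = virtual_BK n].
Proof.
have mid i : (1 <= i <= n)%N ->
    bkq (2 * n) (n - i + 2) (n + i - 2) = central n i.-1.
  by case: i => // i i_n; rewrite /central; congr bkq; lia.
split=> [i i_n|i i_n|i i_n|i i_n|].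
- have /andP[i0 i_n'] := i_n; rewrite /t_dual bkq_prefix; last by lia.
  by rewrite subKn; [apply: bkt_twin|lia].
- by rewrite mid //; exact: central_commute.
- have /andP[i0 i_n'] := i_n; rewrite t_pairE // -twinM ?bktK ?twin1 //.
  exact: bkt_twin.
- rewrite t_midE // {1}central_commute // -mulgA (mulgA (central n i)).
  by rewrite bkqK mul1g bkqK.
apply: generated_eq => x [] [i /= i_n <-].
- have /andP[i0 i_n'] := i_n; rewrite t_pairE //; apply: generated_twin => // j j_n.
  by apply: mem_generated; left; exists j; rewrite /= ?virtual_genE.
- have [S1 SM _] := generatedP (virtual_gens n).
  have Sc j : (j <= n)%N -> generated (virtual_gens n) (central n j).
    case: j => [|j] jn; first by rewrite central0.
    apply: mem_generated; right; exists (n - j)%N => /=; first by lia.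
    by rewrite virtual_mid; [congr central; lia|lia].
  by rewrite t_midE //; apply: SM; apply: Sc; lia.
- have /andP[i0 i_n'] := i_n; rewrite virtual_genE //.
  apply: twin_generated => // j j_n.
  have /andP[j0 j_n'] := j_n.
  by apply: mem_generated; left; exists j; rewrite ?t_pairE.
- rewrite virtual_mid //; set S := (X in generated X).
  have [S1 SM _] := generatedP S.
  have : (n + 1 - i <= n)%N by lia.
  elim: (n + 1 - i)%N => [|j IH] jn; first by rewrite central0.
  have -> : central n j.+1 = t_mid n j.+1 * central n j.
    by rewrite t_midE //= -mulgA bkqK mulg1.
  apply: SM; last by apply: IH; lia.
  by apply: mem_generated; right; exists j.+1.
Qed.
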